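(* Let $\mathbf{A}=(\mathcal{P},\mathcal{L},\parallel)$ and $\mathbf{A}'=(\mathcal{P}',\mathcal{L}',\parallel')$ be affine spaces with $\dim\mathbf{A}'\ge 3$, and let $\varphi:\mathcal{L}\to\mathcal{L}'$ be a bijection satisfying $a\sim b\implies a^\varphi\sim' b^\varphi$ for all $a,b\in\mathcal{L}$. Let $\lambda:\mathcal{P}\to\mathcal{P}'$ be the (well-defined, injective) map $a\cap b\mapsto a^\varphi\cap b^\varphi$ for adjacent $a,b\in\mathcal{L}$. Then each of the following conditions is sufficient for $\lambda$ to be a collineation (equivalently, for $\lambda$ to be surjective): (1) $\mathbf{A}$ or $\mathbf{A}'$ is a finite affine space; (2) $\dim\mathbf{A}\le\dim\mathbf{A}'<\infty$; (3) the order of $\mathbf{A}$ is different from two and every monomorphism of a coordinatizing (skew) field $F$ of $\mathbf{A}$ into a coordinatizing (skew) field $F'$ of $\mathbf{A}'$ is surjective; (4) $\mathbf{A}$ and $\mathbf{A}'$ are both affine spaces of order two.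
   Context: An affine space $\mathbf{A}=(\mathcal{P},\mathcal{L},\parallel)$ has point set $\mathcal{P}$, line set $\mathcal{L}$ and parallelism $\parallel$; its order is the number of points on a line. Lines $a,b$ are related, $a\sim b$, if $a\cap b\ne\emptyset$; adjacent, $a\approx b$, if related and distinct; analogously $\sim'$ in $\mathbf{A}'$. Under the hypotheses, $\dim\mathbf{A}\ge 3$, so $\mathbf{A}$ and $\mathbf{A}'$ are Desarguesian and are coordinatized by (skew) fields $F$ and $F'$, respectively. A collineation $\mathcal{P}\to\mathcal{P}'$ is a bijection mapping collinear triples to collinear triples and non-collinear triples to non-collinear triples. *)

(* Defs.v *)
From Stdlib Require List.
From HB Require Import structures.
From mathcomp Require Import all_boot all_order all_algebra.
Set Implicit Arguments. Unset Strict Implicit. Unset Printing Implicit Defensive.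
Import GRing.Theory.
Local Open Scope ring_scope.

(* Affine space (Lenz's axioms): points, lines (with incidence), parallelism.
   Lines are determined by their points (extensionality axiom). *)
Record affine_space := AffineSpace {
  point : Type;
  line : Type;
  inc : point -> line -> Prop;
  par : line -> line -> Prop;
  ax_line_ext : forall l m, (forall p, inc p l <-> inc p m) -> l = m;
  ax_join : forall p q, p <> q -> exists l, inc p l /\ inc q l;
  ax_join_uniq : forall p q l m, p <> q ->
      inc p l -> inc q l -> inc p m -> inc q m -> l = m;
  ax_two_points : forall l, exists p q, p <> q /\ inc p l /\ inc q l;
  ax_par_refl : forall l, par l l;
  ax_par_sym : forall l m, par l m -> par m l;
  ax_par_trans : forall l m n, par l m -> par m n -> par l n;
  ax_euclid : forall p l, exists m, inc p m /\ par m l;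
  ax_euclid_uniq : forall p l m m',
      inc p m -> par m l -> inc p m' -> par m' l -> m = m';
  ax_triangle : forall p q r p' q' l l' a b a' b',
      ~ (exists n, inc p n /\ inc q n /\ inc r n) ->
      p' <> q' ->
      inc p l -> inc q l -> inc p' l' -> inc q' l' -> par l l' ->
      inc p a -> inc r a -> inc q b -> inc r b ->
      inc p' a' -> par a' a -> inc q' b' -> par b' b ->
      exists r', inc r' a' /\ inc r' b'
}.

Section AffineNotions.
Variable A : affine_space.

Definition related (a b : line A) : Prop := exists p, inc p a /\ inc p b.
Definition adjacent (a b : line A) : Prop := related a b /\ a <> b.

Definition collinear (p q r : point A) : Prop :=
  exists l, inc p l /\ inc q l /\ inc r l.

Definition subspace (S : point A -> Prop) : Prop :=
  (forall p q l, p <> q -> S p -> S q -> inc p l -> inc q l ->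
     forall x, inc x l -> S x) /\
  (forall l m p, (forall x, inc x l -> S x) -> S p -> inc p m -> par m l ->
     forall x, inc x m -> S x).

Definition span (X : point A -> Prop) (p : point A) : Prop :=
  forall S, subspace S -> (forall x, X x -> S x) -> S p.

Definition dim_ge (n : nat) : Prop :=
  exists f : nat -> point A, forall i, (i <= n)%N ->
    ~ span (fun x => exists j, (j <= n)%N /\ j <> i /\ x = f j) (f i).

Definition finite_space : Prop :=
  exists s : list (point A), forall x, List.In x s.

Definition order_two : Prop :=
  forall l : line A, exists p q, p <> q /\ forall x, inc x l <-> x = p \/ x = q.

End AffineNotions.

Definition collineation (A A' : affine_space) (f : point A -> point A') : Prop :=
  bijective f /\
  forall p q r, collinear p q r <-> collinear (f p) (f q) (f r).

Definition skew_field (F : unitRingType) : Prop :=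
  forall x : F, x != 0 -> x \is a GRing.unit.

Section Vect.
Variables (F : unitRingType) (V : lmodType F).

Definition vline_of (S : V -> Prop) (a v : V) : Prop :=
  v != 0 /\ forall x, S x <-> exists t : F, x = a + t *: v.

Definition is_vline (S : V -> Prop) : Prop := exists a v, vline_of S a v.

Definition vpar (S T : V -> Prop) : Prop :=
  exists a b v, vline_of S a v /\ vline_of T b v.
End Vect.

Definition coordinatization (A : affine_space) (F : unitRingType)
    (V : lmodType F) (f : point A -> V) : Prop :=
  let img := fun l : line A => fun x : V => exists p, inc p l /\ f p = x in
  skew_field F /\ bijective f /\
  (forall l, is_vline (img l)) /\
  (forall S, is_vline S -> exists l, forall p, inc p l <-> S (f p)) /\
  (forall l m, par l m <-> vpar (img l) (img m)).

(* Main.v *)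
(* Without any of the four conditions, [lam] is injective and preserves and reflects
   collinearity, and its image [X] meets every line of [A'] in at least two points, because
   [phi] is onto; only the surjectivity of [lam] is at stake.  So let [P] be a point of [A']
   outside [X].

   (1) The lines through [P] partition [A], whereas the equally many lines through a point of
   [X] share that point; counting refutes this.
   (2) If [A] has order two it is finite.  Otherwise preimages of subspaces are subspaces, and
   comparing dimensions along a flag shows that the preimage of a plane through [P] is a plane,
   where disjoint lines are parallel.  Then the two lines joining [P] to [lam x] and [lam y],
   and the line through [P] parallel to the line [lam x, lam y], come from parallel lines of
   [A], which forces the lines [x, y] and [P, lam x] to coincide.
   (3) In the projective closure of [A'], the images of the lines of a parallel class of [A]
   concur, since [X] is not contained in a plane.  Homogeneous coordinates of these points at
   infinity can be chosen to form an additive map [c], which is then semilinear with respect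
   to a monomorphism [F -> F'].  If this is onto, the points at infinity of [A] go to points
   at infinity of [A'], so [lam] is affine and maps lines onto lines.
   (4) Every line of [A'] is contained in [X]. *)

From Stdlib Require Import Classical ClassicalEpsilon FinFun ListDec.
From HB Require Import structures.
From mathcomp Require Import all_boot all_order all_algebra.
Require Import Defs.

Set Implicit Arguments. Unset Strict Implicit. Unset Printing Implicit Defensive.
Import GRing.Theory.

Lemma choice (T U : Type) (R : T -> U -> Prop) :
  (forall x, exists y, R x y) -> exists g : T -> U, forall x, R x (g x).
Proof.
move=> RP; exists (fun x => proj1_sig (constructive_indefinite_description _ (RP x))) => x.
exact: proj2_sig.
Qed.
Arguments choice [T U] R _.

(** * Parallel projection *)

Section Geometry.
Variable A : affine_space.
Implicit Types (o p q r s t w x y z : point A) (l m n k d : line A).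
Implicit Types (S T C : point A -> Prop) (u v : seq (point A)).

Lemma inc_par_eq p l m : inc p l -> inc p m -> par l m -> l = m.
Proof. by move=> pl pm lm; apply: (ax_euclid_uniq pl lm pm (ax_par_refl m)). Qed.

Lemma noncollinear_off a b c m :
  a <> b -> inc a m -> inc b m -> ~ inc c m -> ~ @collinear A a b c.
Proof.
move=> ab am bm cm [n [an [bn cn]]].
by apply: cm; rewrite -(ax_join_uniq ab an bn am bm).
Qed.

Lemma other_point p l : exists q, q <> p /\ inc q l.
Proof.
have [a [b [ab [al bl]]]] := ax_two_points l.
by have [ap|ap] := classic (a = p); [exists b; split=> // bp; apply: ab; rewrite ap bp | exists a].
Qed.

(** The triangle axiom for the triangle [b], [a], [s], with both bases on [l] and the vertex [b]
    shared. *)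
Lemma pasch_parallel a b s z l m k n :
  inc a l -> inc b l -> inc z l -> inc a m -> inc s m -> inc b k -> inc s k ->
  ~ inc b m -> inc z n -> par n m -> exists w, inc w n /\ inc w k.
Proof.
move=> al bl zl am sm bk sk bm zn nm.
have [E|zb] := classic (b = z); first by exists z; split=> //; rewrite -E.
have [E|asN] := classic (a = s).
  exists z; split=> //; suff <- : l = k by [].
  by apply: (@ax_join_uniq A a b) => //; [move=> E'; apply: bm; rewrite -E' | rewrite E].
have nc : ~ exists n, inc b n /\ inc a n /\ inc s n.
  by case=> j [bj [aj sj]]; apply: bm; rewrite -(ax_join_uniq asN aj sj am sm).
have [w [wk wn]] := @ax_triangle A b a s b z l l k m k n nc zb bl al bl zl
  (ax_par_refl l) bk sk am sm bk (ax_par_refl k) zn nm.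
by exists w.
Qed.

(** The triangle [x], [t], [s] is set on its own base with the ends exchanged, so the triangle axiom
    yields the fourth vertex, opposite to [s]. *)
Lemma parallelogram m m' k k' x s t :
  par m' m -> inc x m -> inc s m -> inc t m' -> inc s k -> inc t k ->
  inc x k' -> par k' k -> exists r, inc r k' /\ inc r m'.
Proof.
move=> mm xm sm tm sk tk xk kk.
have [E|mN] := classic (m' = m); first by exists x; rewrite E.
have tNm : ~ inc t m by move=> tm'; apply: mN; apply: (inc_par_eq tm).
have [E|xs] := classic (x = s).
  by exists t; split=> //; rewrite (@inc_par_eq x k' k) // E.
have xt : t <> x by move=> E; apply: tNm; rewrite E.
have [l [tl xl]] := ax_join xt.
have nc : ~ exists n, inc x n /\ inc t n /\ inc s n.
  by case=> j [xj [tj sj]]; apply: tNm; rewrite -(ax_join_uniq xs xj sj xm sm).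
have [r [rm rk]] := @ax_triangle A x t s t x l l m k m' k' nc xt xl tl tl xl
  (ax_par_refl l) xm sm tk sk tm mm xk kk.
by exists r.
Qed.

(** If [S] is a subspace that meets [d], this is the join of [S] and [d], described by a single
    parallel projection and for every order. It serves to bound a span after adjoining a point. *)
Definition cylinder S d x := exists m s, inc x m /\ par m d /\ inc s m /\ S s.

Lemma cylinder_subspace S d : subspace S -> subspace (cylinder S d).
Proof.
move=> [Sl Sp]; split.
  move=> x y l xy [mx [s [xm [mxd [sm Ss]]]]] [my [t [ym [myd [tm St]]]]] xl yl z zl.
  have [E|mN] := classic (mx = my).
    exists mx, s; split=> //; suff <- : l = mx by [].
    by apply: (ax_join_uniq xy) => //; rewrite E.
  have mm : par mx my by apply: ax_par_trans mxd (ax_par_sym myd).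
  have yNm : ~ inc y mx by move=> H; apply: mN; apply: (inc_par_eq H).
  have sNm : ~ inc s my by move=> H; apply: mN; apply: (inc_par_eq sm).
  have sy : s <> y by move=> E; apply: yNm; rewrite -E.
  have st : s <> t by move=> E; apply: sNm; rewrite E.
  (* The diagonal [k] splits the trapezoid [x], [y], [t], [s]: the parallel [n] through [z] crosses
     first [k] and then the side [k2], which lies in [S]. *)
  have [k [sk yk]] := ax_join sy.
  have [k2 [sk2 tk2]] := ax_join st.
  have [n [zn nd]] := ax_euclid z d.
  have nm : par n mx by apply: ax_par_trans nd (ax_par_sym mxd).
  have [w [wn wk]] := pasch_parallel xl yl zl xm sm yk sk yNm zn nm.
  have [w2 [wn2 wk2]] := pasch_parallel yk sk wk ym tm sk2 tk2 sNm wn (ax_par_trans nm mm).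
  exists n, w2; do !split=> //; exact: (Sl s t k2 st).
move=> l m p lJ [mp [p0 [pm [mpd [p0m Sp0]]]]] pm' ml z zm.
have [x [y [xy [xl yl]]]] := ax_two_points l.
have [mx [s [xm [mxd [sm Ss]]]]] := lJ _ xl.
have [my [t [ym [myd [tm St]]]]] := lJ _ yl.
have [E|mN] := classic (mx = my).
  have lm : l = mx by apply: (ax_join_uniq xy) => //; rewrite E.
  exists mp, p0; do !split=> //; suff <- : m = mp by [].
  apply: (inc_par_eq pm') => //; apply: ax_par_trans ml _; rewrite lm.
  by apply: ax_par_trans mxd (ax_par_sym mpd).
have mm : par my mx by apply: ax_par_trans myd (ax_par_sym mxd).
have sNm : ~ inc s my by move=> H; apply: mN; apply: (inc_par_eq sm) => //; apply: ax_par_sym.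
have st : s <> t by move=> E; apply: sNm; rewrite E.
(* [k] is the shadow of [l] in [S] along [d], and [m0] its parallel through the shadow [p0] of [p].
   It remains to see that the parallel [n] to [d] through [z] meets [m0]. *)
have [k [sk tk]] := ax_join st.
have [m0 [p0m0 m0k]] := ax_euclid p0 k.
have Sk : forall x, inc x k -> S x by move=> j; apply: (Sl s t k st).
have Sm0 : forall x, inc x m0 -> S x by apply: (Sp k m0 p0).
have [n [zn nd]] := ax_euclid z d.
have nmp : par n mp by apply: ax_par_trans nd (ax_par_sym mpd).
suff [w [wn wm0]] : exists w, inc w n /\ inc w m0 by exists n, w; do !split => //; apply: Sm0.
have close kp w : inc p kp -> inc w kp -> inc w n -> par m0 kp ->
    exists w, inc w n /\ inc w m0.
  move=> pk wk wn mk; have [r [rm rn]] := parallelogram nmp p0m pm wn pk wk p0m0 mk.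
  by exists r.
(* The triangle [x], [y], [r], with [xr] parallel to [k] and [yr] parallel to [d], is copied onto
   the base [p], [z]; its third vertex [w] feeds [close]. *)
have [kx [xkx kxk]] := ax_euclid x k.
have [r [rkx rmy]] := parallelogram mm xm sm tm sk tk xkx kxk.
have [E|yr] := classic (y = r).
  apply: (close m z) => //; apply: ax_par_trans m0k _; apply: ax_par_sym.
  apply: ax_par_trans ml _; suff -> : l = kx by [].
  by apply: (ax_join_uniq xy) => //; rewrite E.
have [E|pz] := classic (p = z).
  by exists p0; rewrite (@inc_par_eq z n mp) // -E.
have nc : ~ exists n, inc x n /\ inc y n /\ inc r n.
  case=> j [xj [yj rj]]; apply: mN; rewrite (@inc_par_eq x mx my) //; last exact: ax_par_sym.
  by rewrite -(ax_join_uniq yr yj rj ym rmy).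
have [kp [pkp kpk]] := ax_euclid p k.
have [w [wk wn]] := @ax_triangle A x y r p z l m kx my kp n nc pz xl yl pm' zm
  (ax_par_sym ml) xkx rkx ym rmy pkp (ax_par_trans kpk (ax_par_sym kxk)) zn
  (ax_par_trans nd (ax_par_sym myd)).
by apply: (close kp w) => //; apply: ax_par_trans m0k (ax_par_sym kpk).
Qed.
End Geometry.

(** * Span, exchange and dimension *)

Lemma In_map_mem (T : Type) (f : nat -> T) (s : seq nat) y :
  List.In y (map f s) <-> exists j, j \in s /\ y = f j.
Proof.
elim: s => [|i s IH] /=; first by split=> // -[j []].
split=> [[<-|/IH[j [js ->]]]|[j []]].
- by exists i; rewrite mem_head.
- by exists j; rewrite inE js orbT.
- rewrite inE => /orP[/eqP-> ->|js yE]; [by left|right].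
  by apply/IH; exists j.
Qed.

Lemma In_nth_size (T : Type) (x0 : T) (u : seq T) x :
  List.In x u -> exists j, (j < size u)%N /\ x = nth x0 u j.
Proof.
elim: u => [|y u IH] //= [<-|/IH[j [ju ->]]]; first by exists 0%N.
by exists j.+1.
Qed.

Lemma In_rcons (T : Type) (u : seq T) x y : List.In y (rcons u x) <-> List.In y u \/ y = x.
Proof.
elim: u => [|z u IH] /=; first by split=> [[->|//]|[//|->]]; [right|left].
by rewrite IH; tauto.
Qed.

Lemma In_take (T : Type) (n : nat) (u : seq T) x : List.In x (take n u) -> List.In x u.
Proof. by elim: u n => [|y u IH] [|n] //= [->|/IH]; [left|right]. Qed.

Section Dimension.
Variable A : affine_space.
Implicit Types (o p q r s t w x y z : point A) (l m n k d : line A).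
Implicit Types (S T C D : point A -> Prop) (u v : seq (point A)).

Lemma span_subspace C : subspace (span C).
Proof.
split=> [p q l pq Cp Cq pl ql x xl S HS CS|l m p lC Cp pm ml x xm S HS CS].
  by apply: (proj1 HS p q l) => //; [exact: Cp|exact: Cq].
by apply: (proj2 HS l m p) => // [y yl|]; [exact: lC|exact: Cp].
Qed.

Lemma span_gen C x : C x -> span C x.
Proof. by move=> Cx S _; apply. Qed.

Lemma span_sub C D : (forall x, C x -> span D x) -> forall x, span C x -> span D x.
Proof. by move=> CD x; apply=> //; exact: span_subspace. Qed.

Lemma span_mono C D : (forall x, C x -> D x) -> forall x, span C x -> span D x.
Proof. by move=> CD; apply: span_sub => x /CD; exact: span_gen. Qed.

Lemma line_subspace l : subspace (fun x => inc x l).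
Proof.
split=> [p q m pq pl ql pm qm x xm|m k p ml pl pk km x xk].
  by rewrite (ax_join_uniq pq pl ql pm qm).
have [a [b [ab [am bm]]]] := ax_two_points m.
have E : m = l := ax_join_uniq ab am bm (ml _ am) (ml _ bm).
by rewrite -(inc_par_eq pk pl) // -E.
Qed.

Lemma point_subspace p : subspace (fun x => x = p).
Proof.
split=> [a b m ab ap bp|m k a mp _ _ _ x xk]; first by case: ab; rewrite ap.
have [a' [b [ab [am bm]]]] := ax_two_points m.
by case: ab; rewrite (mp _ am) (mp _ bm).
Qed.

Definition adjoin C x := fun y => C y \/ y = x.
Definition adjoin_seq C u := fun y => C y \/ List.In y u.

Lemma cylinder_span_adjoin C o y d x : span C o -> inc o d -> inc y d ->
  span (adjoin C y) x -> cylinder (span C) d x.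
Proof.
move=> Co od yd; apply; first by apply: cylinder_subspace; exact: span_subspace.
move=> z [Cz|->]; last by exists d, o; do !split=> //; exact: ax_par_refl.
have [m [zm md]] := ax_euclid z d.
by exists m, z; do !split=> //; exact: span_gen.
Qed.

(** Let [d] join [y] to a point [o] spanned by [C]. The parallel to [d] through [x] meets the span
    of [C] in a point [s]; so the line [xs] and its parallel [d] through [o] lie in the span of [C]
    and [x], and [d] carries [y]. If [C] spans nothing, then [x = y]. *)
Lemma span_exchange C x y :
  span (adjoin C y) x -> ~ span C x -> span (adjoin C x) y.
Proof.
move=> Cyx Cx.
have [[o Co]|nC] := classic (exists o, span C o); last first.
  apply: span_gen; right; apply: esym; apply: (Cyx _ (point_subspace y)).
  by move=> z [/span_gen Cz|//]; case: nC; exists z.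
have mono : forall z, span C z -> span (adjoin C x) z by apply: span_mono => z Cz; left.
have [<-|oy] := classic (o = y); first exact: mono.
have [d [od yd]] := ax_join oy.
have [m [s [xm [md [sm Cs]]]]] := cylinder_span_adjoin Co od yd Cyx.
have xs : x <> s by move=> E; apply: Cx; rewrite E.
have [sl sp] := span_subspace (adjoin C x).
apply: (sp m d o) => //; [|exact: mono|exact: ax_par_sym].
by apply: (sl x s) => //; [apply: span_gen; right|exact: mono].
Qed.

(** The sequential form suits induction over a growing base set; [dim_geP] relates it to the
    symmetric condition in [dim_ge]. *)
Fixpoint independent C u :=
  if u is x :: u' then ~ span C x /\ independent (adjoin C x) u' else True.

Lemma independent_anti C D u :
  (forall x, C x -> D x) -> independent D u -> independent C u.
Proof.
elim: u C D => [|x u IH] C D CD //= [Dx ind]; split.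
  by move=> Cx; apply: Dx; apply: (span_mono CD).
by apply: IH ind => z [/CD|]; [left|right].
Qed.

Lemma independent_rcons C u x :
  independent C u -> ~ span (adjoin_seq C u) x -> independent C (rcons u x).
Proof.
elim: u C => [|y u IH] C /= ind nx.
  by split=> // Cx; apply: nx; apply: (span_mono _ Cx) => z; left.
case: ind => Cy ind; split=> //; apply: IH => // H; apply: nx.
apply: (span_mono _ H) => z [[Cz|->]|zu]; [by left|right; by left|right; by right].
Qed.

Lemma independent_take C (n : nat) u : independent C u -> independent C (take n u).
Proof. by elim: u n C => [|x u IH] [|n] C //= [Cx /IH]. Qed.

(** Heads of the list are kept as long as [C] and the tail still span [x]; the first head for which
    this fails is the one that [x] replaces, by exchange. *)
Lemma steinitz_swap C u x :
  ~ span C x -> span (adjoin_seq C u) x ->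
  exists v, size u = (size v).+1 /\
    forall z, span (adjoin_seq C u) z -> span (adjoin_seq (adjoin C x) v) z.
Proof.
move=> Cx; elim: u => [|y u IH] Cux.
  by case: Cx; apply: (span_mono _ Cux) => z [].
have [H|H] := classic (span (adjoin_seq C u) x).
  have [v [sv vE]] := IH H; exists (y :: v); split=> /=; first by rewrite sv.
  have up : forall z, span (adjoin_seq C u) z -> span (adjoin_seq (adjoin C x) (y :: v)) z.
    by move=> z /vE; apply: span_mono => t [tC|tv]; [left|right; right].
  apply: span_sub => z [Cz|[<-|zu]].
  - by apply: up; apply: span_gen; left.
  - by apply: span_gen; right; left.
  - by apply: up; apply: span_gen; right.
exists u; split=> //.
have yx : span (adjoin (adjoin_seq C u) x) y.
  apply: span_exchange => //; apply: (span_mono _ Cux) => z [Cz|[<-|zu]];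
    [by left; left|by right|by left; right].
apply: span_sub => z [Cz|[<-|zu]].
- by apply: span_gen; left; left.
- apply: (span_mono _ yx) => t [[tC|tu]|->]; [by left; left|by right|by left; right].
- by apply: span_gen; right.
Qed.

Lemma steinitz C u v :
  independent C v -> (forall x, List.In x v -> span (adjoin_seq C u) x) ->
  (size v <= size u)%N.
Proof.
elim: v C u => [|x v IH] C u //= [Cx ind] vu.
have [u' [-> uE]] := steinitz_swap Cx (vu x (or_introl erefl)).
by rewrite ltnS; apply: (IH (adjoin C x)) => // y yv; apply: uE; apply: vu; right.
Qed.

Definition empty_set x := False.

(** Dimension [n] takes [n+1] points. The earlier points are among the other points, which gives one
    direction. Conversely, a point spanned by the [n] others would leave [n] generators for [n+1]
    independent points, against [steinitz]. *)
Lemma dim_geP (n : nat) :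
  dim_ge A n <-> exists u, independent empty_set u /\ size u = n.+1.
Proof.
split=> [[f fP]|[u [ind su]]].
  suff H : forall k m : nat, (m + k <= n.+1)%N ->
      independent (fun x => exists j, (j < m)%N /\ x = f j) (map f (iota m k)).
    exists (map f (iota 0 n.+1)); rewrite size_map size_iota; split=> //.
    by apply: independent_anti (H n.+1 0%N _).
  elim=> [|k IH] m //= mk; split.
    have mn : (m <= n)%N by rewrite -ltnS (leq_trans _ mk) // addnS ltnS leq_addr.
    move=> H; apply: (fP m mn); apply: (span_mono _ H) => x [j [jm ->]].
    exists j; split; first exact: ltnW (leq_trans jm mn).
    by split=> // E; rewrite E ltnn in jm.
  apply: independent_anti (IH m.+1 _); last by rewrite addSnnS.
  by move=> x [[j [jm ->]]|->]; [exists j; rewrite ltnS ltnW|exists m].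
case: u ind su => [//|x0 u'] /=; set u := x0 :: u' => ind su.
exists (nth x0 u) => i i_n H.
suff : (size u <= size (map (nth x0 u) (rem i (iota 0 n.+1))))%N.
  by rewrite size_map size_rem ?mem_iota // size_iota /= su ltnn.
apply: (@steinitz empty_set) => // x /(In_nth_size x0)[j [ju ->]].
rewrite [size u]su ltnS in ju.
have gen (k : nat) : (k <= n)%N -> k <> i ->
    span (adjoin_seq empty_set [seq nth x0 u j | j <- rem i (iota 0 n.+1)]) (nth x0 u k).
  move=> kn /eqP ki; apply: span_gen; right; apply/In_map_mem; exists k.
  by rewrite mem_rem_uniq ?iota_uniq // inE ki mem_iota.
have [->|/eqP ji] := eqVneq j i; last exact: gen.
by apply: (span_sub _ H) => y [k [kn [ki ->]]]; apply: gen.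
Qed.

Lemma dim_ge_leq (n m : nat) : (m <= n)%N -> dim_ge A n -> dim_ge A m.
Proof.
move=> mn [f fP]; exists f => i im H; apply: (fP i (leq_trans im mn)).
by apply: (span_mono _ H) => x [j [jm [ji ->]]]; exists j; split=> //; apply: leq_trans mn.
Qed.

Lemma dim_ge_triangle : dim_ge A 2 ->
  exists a b c : point A, [/\ a <> b, a <> c, b <> c & ~ collinear a b c].
Proof.
case=> f fP.
have neq i j : (i <= 2)%N -> (j <= 2)%N -> j <> i -> f i <> f j.
  by move=> i2 j2 ji E; apply: (fP i i2); apply: span_gen; exists j.
exists (f 0%N), (f 1%N), (f 2%N); split; try exact: neq.
move=> [l [l0 [l1 l2]]]; apply: (fP 0%N) => //.
apply: (proj1 (span_subspace _) (f 1%N) (f 2%N) l) => //; first exact: neq.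
  by apply: span_gen; exists 1%N.
by apply: span_gen; exists 2%N.
Qed.

Lemma finite_dim_spanning : (exists n : nat, ~ dim_ge A n) ->
  exists u, forall x, span (adjoin_seq empty_set u) x.
Proof.
move=> [n nd]; apply: NNPP => H.
suff [u [ind su]] : exists u, independent empty_set u /\ size u = n.+1.
  by apply: nd; apply/dim_geP; exists u.
elim: (n.+1) => [|k [u [ind su]]]; first by exists [::].
have [x ux] : exists x, ~ span (adjoin_seq empty_set u) x.
  by apply: NNPP => H'; apply: H; exists u => x; apply: NNPP => ?; apply: H'; exists x.
by exists (rcons u x); rewrite size_rcons su; split=> //; apply: independent_rcons.
Qed.

(* If [m2] were not parallel to [m1], the cylinder over [m1] in direction [m2] would
   contain [T]. *)
Lemma plane_disjoint_parallel T m1 m2 :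
  subspace T ->
  (forall u, independent empty_set u -> (forall x, List.In x u -> T x) -> (size u <= 3)%N) ->
  (forall x, inc x m1 -> T x) -> (forall x, inc x m2 -> T x) ->
  ~ related m1 m2 -> par m1 m2.
Proof.
move=> sT T3 m1T m2T nrel; apply: NNPP => npar.
have [o [o2 [oo2 [om o2m]]]] := ax_two_points m1.
have [n [on nm2]] := ax_euclid o m2.
have [p0 [p0o p0n]] := other_point o n.
have p0m1 : ~ inc p0 m1.
  by move=> H; apply: npar; rewrite -(ax_join_uniq p0o p0n on H om).
have [p [q [pq [pm2 qm2]]]] := ax_two_points m2.
have Tp0 : T p0 by apply: (proj2 sT m2 n o) => //; exact: m1T.
pose C := adjoin (adjoin empty_set o) o2.
have Cm1 x : span C x -> inc x m1.
  by move=> H; apply: (H _ (line_subspace m1)) => y [[[]|->]|->].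
have Cp : span (adjoin C p0) p.
  apply: NNPP => H; suff : (4 <= 3)%N by [].
  apply: (T3 [:: o; o2; p0; p]); last first.
    by move=> x /= [<-|[<-|[<-|[<-|//]]]] //; [exact: m1T|exact: m1T|exact: m2T].
  rewrite /=; do !split=> //; last by move=> /Cm1.
    by move=> /(_ empty_set); case.
  by move=> H'; apply: oo2; apply: esym; apply: (H' _ (point_subspace o)) => x [].
have Co : span C o by apply: span_gen; left; right.
have [m [s [pm [mn [sm /Cm1 sm1]]]]] := cylinder_span_adjoin Co on p0n Cp.
apply: nrel; exists s; split=> //; rewrite -(@inc_par_eq _ p m m2) //.
exact: ax_par_trans mn nm2.
Qed.

(** * Lines with at least three points, and spaces of order two *)

Definition line_closed S :=
  forall p q l, p <> q -> S p -> S q -> inc p l -> inc q l -> forall x, inc x l -> S x.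

(** To reach [q] on the parallel [m], take a third point [r] on the line joining [p] to a point [x]
    of [l]: the line [rq] meets [l] in a point [s], and both [r] and [s] lie in [S]. *)
Lemma line_closed_subspace S :
  (forall p q l, exists r, [/\ inc r l, r <> p & r <> q]) ->
  line_closed S -> subspace S.
Proof.
move=> big Sl; split=> // l m p lS Sp pm ml q qm.
have [pl|pl] := classic (inc p l); first by apply: lS; rewrite -(inc_par_eq pm pl ml).
have [<-|pq] := classic (p = q); first by [].
have [x [y [_ [xl _]]]] := ax_two_points l.
have px : p <> x by move=> E; apply: pl; rewrite E.
have [k [pk xk]] := ax_join px.
have [r [rk rp rx]] := big p x k.
have Sr : S r by apply: (Sl p x k) => //; exact: lS.
have xm : ~ inc x m by move=> xm; apply: pl; rewrite -(inc_par_eq xm xl ml).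
have rm : ~ inc r m by move=> rm; apply: xm; rewrite (ax_join_uniq rp rm pm rk pk).
have rq : r <> q by move=> E; apply: rm; rewrite E.
have [j [rj qj]] := ax_join rq.
have [s [sl sj]] := pasch_parallel pk rk xk pm qm rj qj rm xl (ax_par_sym ml).
apply: (Sl r s j) => //; last exact: lS.
move=> E; have rl : inc r l by rewrite E.
by apply: pl; rewrite -(ax_join_uniq rx rk xk rl xl).
Qed.

(** Surjections compare the sizes of lines; taking them as maps on all points avoids a type of
    points for each line. *)
Definition line_onto l m :=
  exists g : point A -> point A, forall y, inc y m -> exists x, inc x l /\ g x = y.

Lemma line_onto_trans l m n : line_onto l m -> line_onto m n -> line_onto l n.
Proof.
move=> [g gP] [h hP]; exists (h \o g) => z /hP[y [/gP[x [xl <-]] <-]].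
by exists x.
Qed.

(** Parallel projection along a line [d] that joins a point of [l] to a point of [m], both different
    from the intersection. *)
Lemma line_onto_meet l m : related l m -> line_onto l m.
Proof.
move=> [o [ol om]].
have [<-|lm] := classic (l = m); first by exists id => y ym; exists y.
have [x0 [x0o x0l]] := other_point o l.
have [y0 [y0o y0m]] := other_point o m.
have x0m : ~ inc x0 m by move=> x0m; apply: lm; rewrite (ax_join_uniq x0o x0l ol x0m om).
have x0y0 : x0 <> y0 by move=> E; apply: x0m; rewrite E.
have [d [x0d y0d]] := ax_join x0y0.
have od : ~ inc o d by move=> od; apply: x0m; rewrite (ax_join_uniq y0o y0m om y0d od).
pose R x y := inc y m /\ exists n, [/\ inc x n, inc y n & par n d].
exists (fun x => epsilon (inhabits x) (R x)) => y ym.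
have [n [yn nd]] := ax_euclid y d.
have [x [xn xl]] := pasch_parallel y0m om ym y0d x0d ol x0l od yn nd.
exists x; split=> //.
have [zm [n' [xn' zn' nd']]] := epsilon_spec (inhabits x) (R x)
  (ex_intro _ y (conj ym (ex_intro _ n (And3 xn yn nd)))).
(* If the chosen image differed from [y], the common parallel to [d] would be [m]; then [d] and [m],
   both through [y0], would be equal and contain [o]. *)
apply: NNPP => zy.
have nn : n = n' by apply: (inc_par_eq xn) => //; apply: ax_par_trans nd (ax_par_sym nd').
have E : n' = m by apply: (ax_join_uniq zy) => //; rewrite -nn.
apply: od; rewrite -(@inc_par_eq _ y0 m d) // -E //.
Qed.

Lemma line_ontoP l m : line_onto l m.
Proof.
have [p [_ [_ [pl _]]]] := ax_two_points l.
have [q [_ [_ [qm _]]]] := ax_two_points m.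
have [E|pq] := classic (p = q); first by apply: line_onto_meet; exists p; rewrite {2}E.
have [k [pk qk]] := ax_join pq.
by apply: (@line_onto_trans l k m); apply: line_onto_meet; [exists p|exists q].
Qed.

(** A line with no points besides [p] and [q] could be mapped onto every other line, and then all
    lines would have just two points. *)
Lemma third_point : ~ order_two A ->
  forall p q l, exists r, [/\ inc r l, r <> p & r <> q].
Proof.
move=> no2 p q l; apply: NNPP => H; apply: no2 => m.
have lpq x : inc x l -> x = p \/ x = q.
  by move=> xl; apply: NNPP => /not_or_and[xp xq]; apply: H; exists x.
have [g gP] := line_ontoP l m.
have [a [b [ab [am bm]]]] := ax_two_points m.
have mg y : inc y m -> y = g p \/ y = g q.
  by move=> /gP[x [/lpq[->|->] <-]]; [left|right].
exists a, b; split=> // x; split=> [xm|[->|->] //].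
case: (mg _ am) (mg _ bm) (mg _ xm) ab => -> [->|->] [->|->] ab;
  first [by left | by right | by case: ab].
Qed.

Lemma order_two_span_finite : order_two A -> forall u,
  exists v, forall x, span (adjoin_seq empty_set u) x -> List.In x v.
Proof.
move=> o2; elim=> [|y u [v vP]].
  by exists [::] => x; apply; [split=> [? ? ? ? []|? ? ? ? []]|move=> ? [|]].
have [[o uo]|nu] := classic (exists o, span (adjoin_seq empty_set u) o); last first.
  exists [:: y] => x H; left; apply: esym; apply: (H _ (point_subspace y)).
  by move=> z [//|/= [->//|zu]]; case: nu; exists z; apply: span_gen; right.
have uyE x : span (adjoin_seq empty_set (y :: u)) x ->
    span (adjoin (adjoin_seq empty_set u) y) x.
  by apply: span_mono => z [//|/= [->|zu]]; [right|left; right].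
have [oyE|oy] := classic (o = y).
  exists v => x /uyE H; apply: vP; apply: (span_sub _ H) => z [/span_gen //|->].
  by rewrite -oyE.
have [d [od yd]] := ax_join oy.
(* [q] is the second point of the line through [s] in direction [d], so adjoining [y] at most
   doubles the list. *)
have other s : exists q, forall m x, inc s m -> par m d -> inc x m -> x = s \/ x = q.
  have [m [sm md]] := ax_euclid s d.
  have [a [b [ab abP]]] := o2 m.
  have mE m' : inc s m' -> par m' d -> m' = m.
    by move=> sm' m'd; apply: (inc_par_eq sm') => //; apply: ax_par_trans m'd (ax_par_sym md).
  have [sa|sb] := (abP s).1 sm; [exists b|exists a];
    by move=> m' x sm' m'd; rewrite (mE m') // => /abP[] ->; first [by left|by right].
have [e eP] := choice _ other.
exists (v ++ map e v) => x /uyE /(cylinder_span_adjoin uo od yd)[m [s [xm [md [sm /vP sv]]]]].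
apply/List.in_or_app; case: (eP s m x sm md xm) => ->; [by left|right].
exact: List.in_map.
Qed.

End Dimension.

(** * Maps between line sets *)

Section LineMap.
Variables (A A' : affine_space) (phi : line A -> line A') (lam : point A -> point A').
Hypothesis dim_A' : dim_ge A' 2.
Hypothesis phi_bij : bijective phi.
Hypothesis lam_meet : forall a b p, adjacent a b -> inc p a -> inc p b ->
  inc (lam p) (phi a) /\ inc (lam p) (phi b).

Lemma line_map_surj m : exists l, phi l = m.
Proof. by case: phi_bij => psi _ psiK; exists (psi m). Qed.

Lemma source_off_line (l : line A) : exists p, ~ inc p l.
Proof.
have [a [b [c [ab ac bc nc]]]] := dim_ge_triangle dim_A'.
have [m1 [am1 bm1]] := ax_join ab.
have [m2 [am2 cm2]] := ax_join ac.
have [l1 l1E] := line_map_surj m1; have [l2 l2E] := line_map_surj m2.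
have l12 : l1 <> l2.
  by move=> E; apply: nc; exists m2; do !split=> //; rewrite -l2E -E l1E.
have [k kl] : exists k, k <> l.
  have [E|E] := classic (l1 = l); last by exists l1.
  by exists l2 => E'; apply: l12; rewrite E.
apply: NNPP => H; apply: kl.
have onl p : inc p l by apply: NNPP => ?; apply: H; exists p.
have [p [q [pq [pk qk]]]] := ax_two_points k.
by apply: (ax_join_uniq pq).
Qed.

Lemma source_second_line p (l : line A) : inc p l -> exists m, inc p m /\ m <> l.
Proof.
move=> pl; have [q ql] := source_off_line l.
have pq : p <> q by move=> E; apply: ql; rewrite -E.
have [m [pm qm]] := ax_join pq.
by exists m; split=> // E; apply: ql; rewrite -E.
Qed.

Lemma source_pencil : exists (x : point A) l m, [/\ l <> m, inc x l & inc x m].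
Proof.
have [a [b [c [ab _ _ _]]]] := dim_ge_triangle dim_A'.
have [m' _] := ax_join ab; have [l _] := line_map_surj m'.
have [x [_ [_ [xl _]]]] := ax_two_points l.
have [m [xm ml]] := source_second_line xl.
by exists x, m, l.
Qed.

Lemma point_map_inc p l : inc p l -> inc (lam p) (phi l).
Proof.
move=> pl; have [m [pm ml]] := source_second_line pl.
by apply: (proj1 (@lam_meet l m p _ pl pm)); split; [exists p|move=> E; apply: ml].
Qed.

(** The lines [pr] and [qr] are distinct, but their images share [lam p] and [lam r], so injectivity
    of [phi] forces these two points to agree. *)
Lemma point_map_merge p q r :
  p <> q -> lam p = lam q -> ~ collinear p q r -> lam r = lam p.
Proof.
move=> pq E nc; have [l [pl ql]] := ax_join pq.
have rl : ~ inc r l by move=> rl; apply: nc; exists l.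
have pr : p <> r by move=> E'; apply: rl; rewrite -E'.
have qr : q <> r by move=> E'; apply: rl; rewrite -E'.
have [m [pm rm]] := ax_join pr; have [k [qk rk]] := ax_join qr.
apply: NNPP => rp; apply: nc; exists m; do !split=> //.
suff -> : m = k by [].
apply: (bij_inj phi_bij); apply: (ax_join_uniq rp); try exact: point_map_inc.
by rewrite E; exact: point_map_inc.
Qed.

(** One identification spreads over all of [A] and makes [lam] constant. Then all lines of [A'] pass
    through one point, which a triangle in [A'] excludes. *)
Lemma point_map_inj : injective lam.
Proof.
move=> p q E; apply: NNPP => pq; have [l [pl ql]] := ax_join pq.
have off r : ~ inc r l -> lam r = lam p.
  by move=> rl; apply: (point_map_merge pq) => //; exact: noncollinear_off rl.
have all_p r : lam r = lam p.
  have [rl|] := classic (inc r l); last exact: off.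
  have [<-|pr] := classic (p = r); first by [].
  have [s sl] := source_off_line l.
  have ps : p <> s by move=> E'; apply: sl; rewrite -E'.
  apply: (point_map_merge ps); first by rewrite off.
  move=> [k [pk [sk rk]]]; apply: sl.
  by rewrite -(ax_join_uniq pr pk rk pl rl).
have all_m m : inc (lam p) m.
  have [k <-] := line_map_surj m; have [r [_ [_ [rk _]]]] := ax_two_points k.
  by rewrite -(all_p r); exact: point_map_inc.
have [a [b [c [ab ac bc nc]]]] := dim_ge_triangle dim_A'.
have [m1 [am1 bm1]] := ax_join ab.
have [m2 [am2 cm2]] := ax_join ac.
have [m3 [bm3 cm3]] := ax_join bc.
have [pa|pa] := classic (lam p = a).
  by apply: nc; exists m3; rewrite -pa.
apply: nc; exists m1; do !split=> //.
by rewrite (ax_join_uniq pa (all_m m1) am1 (all_m m2) am2).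
Qed.

Lemma point_map_incE p l : inc (lam p) (phi l) <-> inc p l.
Proof.
split; last exact: point_map_inc.
move=> ppl; have [q [_ [_ [ql _]]]] := ax_two_points l.
have [->|pq] := classic (p = q); first by [].
have [k [pk qk]] := ax_join pq.
suff <- : k = l by [].
apply: (bij_inj phi_bij); apply: (@ax_join_uniq A' (lam p) (lam q)) => //;
  try exact: point_map_inc.
by move/point_map_inj.
Qed.

Lemma surjective_collineation :
  (forall P, exists p, lam p = P) -> collineation lam.
Proof.
move=> surj; have [g gP] := choice _ surj.
split; first by exists g => // p; apply: point_map_inj; rewrite gP.
move=> p q r; split=> [[l [pl [ql rl]]]|[m [pm [qm rm]]]].
  by exists (phi l); do !split; apply/point_map_incE.
have [l lE] := line_map_surj m; exists l.
by do !split; apply/point_map_incE; rewrite lE.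
Qed.
End LineMap.

(** * Surjectivity in the finite, finite-dimensional and order-two cases *)

Section FullEmbedding.
Variables (A A' : affine_space) (phi : line A -> line A') (lam : point A -> point A').
Hypothesis phi_bij : bijective phi.
Hypothesis lam_inj : injective lam.
Hypothesis lam_incE : forall p l, inc (lam p) (phi l) <-> inc p l.
Hypothesis pencil : exists (x : point A) l m, [/\ l <> m, inc x l & inc x m].

Let phi_surj m : exists l, phi l = m.
Proof. by case: phi_bij => psi _ psiK; exists (psi m). Qed.

Lemma secant P : exists p q l, [/\ p <> q, inc p l, inc q l & inc P (phi l)].
Proof.
have [x [l [_ [_ xl _]]]] := pencil.
have [E|xP] := classic (lam x = P).
  have [y [yx yl]] := other_point x l.
  by exists y, x, l; split=> //; rewrite -E; apply/lam_incE.
have [m [xm Pm]] := ax_join xP; have [k kE] := phi_surj m.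
have [p [q [pq [pk qk]]]] := ax_two_points k.
by exists p, q, k; rewrite kE.
Qed.

Lemma image_generates S : subspace S -> (forall x, S (lam x)) -> forall P, S P.
Proof.
move=> [Sl _] SX P; have [p [q [l [pq pl ql Pl]]]] := secant P.
apply: (Sl (lam p) (lam q) (phi l)) => //; first by move/lam_inj.
  by apply/lam_incE.
by apply/lam_incE.
Qed.

Lemma order_two_surj : order_two A' -> forall P, exists p, lam p = P.
Proof.
move=> o2 P; have [p [q [l [pq pl ql Pl]]]] := secant P.
have [a [b [ab abP]]] := o2 (phi l).
have /abP pab : inc (lam p) (phi l) by apply/lam_incE.
have /abP qab : inc (lam q) (phi l) by apply/lam_incE.
have lpq : lam p <> lam q by move/lam_inj.
case/abP: Pl => ->; case: pab => pE; case: qab => qE;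
  first [by exists p | by exists q | by case: lpq; rewrite pE qE].
Qed.

(* If [P] were missed, its pencil would split [A] into as many lines as there are
   lines through a point [x]; mapping each of them onto the corresponding line
   through [x] covers [x] several times. *)
Lemma finite_surj : finite_space A -> forall P, exists p, lam p = P.
Proof.
move=> [s sP] P; apply: NNPP => nP.
have PX x : lam x <> P by move=> E; apply: nP; exists x.
have [x [l1 [l2 [l12 xl1 xl2]]]] := pencil.
have [onto ontoP] : exists G : line A * line A -> point A -> point A, forall lm y,
    inc y lm.2 -> exists x, inc x lm.1 /\ G lm x = y.
  apply: (choice (fun lm g => forall y, inc y lm.2 -> exists x, inc x lm.1 /\ g x = y)) => lm.
  exact: line_ontoP.
have [M MP] : exists M : point A -> line A, forall p, inc p (M p) /\ inc P (phi (M p)).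
  apply: (choice (fun p l => inc p l /\ inc P (phi l))) => p.
  have [m [pm Pm]] := ax_join (PX p); have [l lE] := phi_surj m.
  by exists l; rewrite -lE in pm Pm; split=> //; apply/lam_incE.
have [L LP] : exists L : line A -> line A, forall m, inc x (L m) /\ par (phi (L m)) (phi m).
  apply: (choice (fun m l => inc x l /\ par (phi l) (phi m))) => m.
  have [l' [xl lm]] := ax_euclid (lam x) (phi m); have [l lE] := phi_surj l'.
  by exists l; rewrite lE; split=> //; apply/lam_incE; rewrite lE.
pose g p := onto (M p, L (M p)) p.
have cover l y : inc x l -> inc y l -> exists p, g p = y /\ L (M p) = l.
  move=> xl yl; have [m' [Pm ml]] := ax_euclid P (phi l).
  have [m mE] := phi_surj m'; rewrite -mE in Pm ml.
  have LE : L m = l.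
    have [xL Lm] := LP m; apply: (bij_inj phi_bij).
    apply: (@inc_par_eq _ (lam x)); try by apply/lam_incE.
    exact: ax_par_trans Lm ml.
  have [p [pm pE]] := ontoP (m, l) y yl.
  have ME : M p = m.
    have [pM PM] := MP p; apply: (bij_inj phi_bij).
    by apply: (ax_join_uniq (PX p)) => //; apply/lam_incE.
  by exists p; rewrite /g ME LE.
have fin : FinFun.Finite (point A) by exists s.
have surj : Surjective g.
  move=> y; have [->|xy] := classic (y = x).
    by have [p [gp _]] := cover l1 x xl1 xl1; exists p.
  by have [l [yl xl]] := ax_join xy; have [p [gp _]] := cover l y xl yl; exists p.
have eqdec : ListDec.decidable_eq (point A) by move=> a b; exact: classic.
have ginj := (Endo_Injective_Surjective fin eqdec g).2 surj.
have [p1 [g1 L1]] := cover l1 x xl1 xl1; have [p2 [g2 L2]] := cover l2 x xl2 xl2.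
by apply: l12; rewrite -L1 -L2 (ginj p1 p2) // g1.
Qed.

Lemma finite_source : finite_space A' -> finite_space A.
Proof.
move=> [s sP]; have [x _] := pencil.
exists (List.map (fun P => epsilon (inhabits x) (fun p => lam p = P)) s) => p.
apply/List.in_map_iff; exists (lam p); split=> //; apply: lam_inj.
by apply: (epsilon_spec (inhabits x) (fun q => lam q = lam p)); exists p.
Qed.

Hypothesis A_big : ~ order_two A.

(** [lam] is not known to respect parallelism, so only closure under lines is pulled back directly;
    third points on the lines of [A] give the rest. *)
Lemma preimage_subspace S : subspace S -> subspace (fun p => S (lam p)).
Proof.
move=> [Sl _]; apply: line_closed_subspace; first exact: third_point.
move=> p q l pq Sp Sq pl ql x xl.
by apply: (Sl (lam p) (lam q) (phi l)) => //; first move/lam_inj; try by apply/lam_incE.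
Qed.

(** With one point more than [v], the list [u] bounds the dimension of [A'] from below, so [v] does
    not generate [A']. The image of [lam] does, hence some [lam x] lies outside the span of [v];
    adjoining [x] and [lam x] keeps the surplus of one. *)
Lemma preimage_independent_extend (u : seq (point A)) (v : seq (point A')) :
  (forall n, dim_ge A n -> dim_ge A' n) ->
  independent (@empty_set A) u ->
  (forall p, List.In p u -> span (adjoin_seq (@empty_set A') v) (lam p)) ->
  (size u = (size v).+1)%N -> (0 < size v)%N ->
  exists x, independent (@empty_set A) (rcons u x) /\
    (forall p, List.In p (rcons u x) -> span (adjoin_seq (@empty_set A') (lam x :: v)) (lam p)).
Proof.
move=> dimAA' ind uv suv v0; set S := span _ in uv.
have [x nx] : exists x, ~ S (lam x).
  apply: NNPP => H.
  have [u' [ind' su']] : exists u', independent (@empty_set A') u' /\ size u' = (size v).+1.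
    by rewrite -(prednK v0); apply/dim_geP/dimAA'/dim_geP; exists u; rewrite suv prednK.
  suff : (size u' <= size v)%N by rewrite su' ltnn.
  apply: (steinitz ind') => P _; apply: (image_generates (span_subspace _)) => x.
  by apply: NNPP => nx; apply: H; exists x.
exists x; split.
  apply: independent_rcons => // ux; apply: nx.
  apply: (ux (fun p => S (lam p))); first exact: preimage_subspace (span_subspace _).
  by move=> y [//|/uv].
have up P : S P -> span (adjoin_seq (@empty_set A') (lam x :: v)) P.
  by apply: span_mono => z [//|zv]; right; right.
move=> p /In_rcons[/uv/up //|->]; apply: span_gen; right; by left.
Qed.

(** A surplus of independent points over [v] could be carried on for ever by
    [preimage_independent_extend], giving [A], and with it [A'], unbounded dimension. *)
Lemma plane_preimage (v : seq (point A')) :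
  (exists N, ~ dim_ge A' N) -> (forall n, dim_ge A n -> dim_ge A' n) ->
  (0 < size v)%N -> forall u,
  independent (@empty_set A) u ->
  (forall p, List.In p u -> span (adjoin_seq (@empty_set A') v) (lam p)) ->
  (size u <= size v)%N.
Proof.
move=> [N nN] dimAA' v0 u0 ind0 uv0; rewrite leqNgt; apply/negP => lt.
suff grow k : exists u v, [/\ independent (@empty_set A) u, (0 < size v)%N,
    (forall p, List.In p u -> span (adjoin_seq (@empty_set A') v) (lam p)),
    (size u = (size v).+1)%N & (k < size u)%N].
  have [u [w [ind _ _ _ ku]]] := grow N; apply: nN; apply: dimAA'.
  apply: (@dim_ge_leq _ (size u).-1); first by rewrite -ltnS prednK // (leq_ltn_trans _ ku).
  by apply/dim_geP; exists u; rewrite prednK // (leq_ltn_trans _ ku).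
elim: k => [|k [u [w [ind w0 uw suw ku]]]]; last first.
  have [x [indx xw]] := preimage_independent_extend dimAA' ind uw suw w0.
  by exists (rcons u x), (lam x :: w); split=> //; rewrite size_rcons // suw.
exists (take (size v).+1 u0), v; split=> //; rewrite ?size_takel //.
  exact: independent_take.
by move=> p pu; apply: uv0; exact: In_take pu.
Qed.

Lemma finite_dim_surj :
  (exists N, ~ dim_ge A' N) -> (forall n, dim_ge A n -> dim_ge A' n) ->
  forall P, exists p, lam p = P.
Proof.
move=> fin dimAA' P; apply: NNPP => nP.
have PX x : lam x <> P by move=> E; apply: nP; exists x.
have [x [k1 [k2 [k12 xk1 xk2]]]] := pencil.
have [l1' [xl1 Pl1]] := ax_join (PX x); have [l1 l1E] := phi_surj l1'.
rewrite -l1E in xl1 Pl1.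
have [y yl1] : exists y, ~ inc y l1.
  have [k [kl xk]] : exists k, k <> l1 /\ inc x k.
    have [E|k1l] := classic (k1 = l1); last by exists k1.
    by exists k2; split=> // E'; apply: k12; rewrite E.
  have [y [yx yk]] := other_point x k.
  exists y => yl1; apply: kl; apply: (ax_join_uniq yx) => //; exact/lam_incE.
have [l2' [yl2 Pl2]] := ax_join (PX y); have [l2 l2E] := phi_surj l2'.
rewrite -l2E in yl2 Pl2.
pose S := span (adjoin_seq (@empty_set A') [:: P; lam x; lam y]).
have SP : S P by apply: span_gen; right; left.
have Sx : S (lam x) by apply: span_gen; right; right; left.
have Sy : S (lam y) by apply: span_gen; right; right; right; left.
have [Sl Sp] : subspace S := span_subspace _.
have xy : x <> y by move=> E; apply: yl1; rewrite -E; apply/lam_incE.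
have [m [xm ym]] := ax_join xy.
have lxy : lam x <> lam y by move/lam_inj.
have xm' : inc (lam x) (phi m) by apply/lam_incE.
have ym' : inc (lam y) (phi m) by apply/lam_incE.
have [n' [Pn nm]] := ax_euclid P (phi m); have [n nE] := phi_surj n'.
rewrite -nE in Pn nm.
have S1 z : inc z l1 -> S (lam z).
  by move=> /lam_incE; exact: (Sl _ _ _ (PX x)).
have Sm z : inc z (phi m) -> S z by exact: (Sl _ _ _ lxy).
have Sn z : inc z n -> S (lam z).
  by move=> /lam_incE; apply: (Sp (phi m) (phi n) P).
have par_of a b : (forall z, inc z a -> S (lam z)) -> (forall z, inc z b -> S (lam z)) ->
    ~ related a b -> par a b.
  apply: plane_disjoint_parallel; first exact: preimage_subspace (span_subspace _).
  by move=> u ind uS; apply: (plane_preimage fin dimAA' (v := [:: P; lam x; lam y])).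
have Pm : ~ inc P (phi m).
  move=> Pm; apply: yl1; apply/lam_incE.
  by rewrite (ax_join_uniq (PX x) xl1 Pl1 xm' Pm).
(* The images of [n] and [m] are parallel and distinct, so [n] and [m] are disjoint. *)
have nm_par : par n m.
  apply: par_of => // [z /lam_incE/Sm //|[z [/lam_incE zn /lam_incE zm]]].
  by apply: Pm; rewrite -(inc_par_eq zn zm nm).
(* The images of [n] and [l1] share [P], which is not an image point; hence [n] and [l1] are
   disjoint or equal. *)
have nl1 : par n l1.
  have [->|nl] := classic (n = l1); first exact: ax_par_refl.
  apply: par_of => // -[z [/lam_incE zn /lam_incE zl]]; apply: nl.
  by apply: (bij_inj phi_bij); apply: (ax_join_uniq (PX z)).
apply: yl1; suff -> : l1 = m by [].
apply: (@inc_par_eq _ x) => //; first exact/lam_incE.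
exact: ax_par_trans (ax_par_sym nl1) nm_par.
Qed.
End FullEmbedding.

(** * Linear spans over skew fields *)

Local Open Scope ring_scope.

Section LinearSpan.
Variables (F : unitRingType) (W : lmodType F).
Hypothesis F_skew : skew_field F.
Implicit Types (u v w : W) (s : seq W).

Fixpoint lspan s w : Prop :=
  if s is u :: s' then exists a, lspan s' (w - a *: u) else w = 0.

Lemma lspan0 s : lspan s 0.
Proof. by elim: s => [|u s IH] //=; exists 0; rewrite scale0r subr0. Qed.

Lemma lspanD s v w : lspan s v -> lspan s w -> lspan s (v + w).
Proof.
elim: s v w => [|u s IH] v w /=; first by move=> -> ->; rewrite addr0.
move=> [a va] [b wb]; exists (a + b).
by rewrite scalerDl opprD addrACA; exact: IH.
Qed.

Lemma lspanZ s a v : lspan s v -> lspan s (a *: v).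
Proof.
elim: s v => [|u s IH] v /=; first by move=> ->; rewrite scaler0.
by move=> [b vb]; exists (a * b); rewrite -scalerA -scalerBr; exact: IH.
Qed.

Lemma lspanN s v : lspan s v -> lspan s (- v).
Proof. by rewrite -scaleN1r; exact: lspanZ. Qed.

Lemma lspanB s v w : lspan s v -> lspan s w -> lspan s (v - w).
Proof. by move=> sv /lspanN; exact: lspanD. Qed.

Lemma lspan_cons u s w : lspan s w -> lspan (u :: s) w.
Proof. by exists 0; rewrite scale0r subr0. Qed.

Lemma lspan_head u s : lspan (u :: s) u.
Proof. by exists 1; rewrite scale1r subrr; exact: lspan0. Qed.

Lemma lspan_sub s s' : {in s, forall u, lspan s' u} -> forall w, lspan s w -> lspan s' w.
Proof.
elim: s => [_ w ->|u s IH H w [a wa]]; first exact: lspan0.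
rewrite -(subrK (a *: u) w); apply: lspanD; last by apply/lspanZ/H; rewrite mem_head.
by apply: IH wa => v vs; apply: H; rewrite inE vs orbT.
Qed.

Lemma lspan_mem s u : u \in s -> lspan s u.
Proof.
elim: s => [|v s IH] //; rewrite inE => /orP[/eqP->|/IH]; first exact: lspan_head.
exact: lspan_cons.
Qed.

Lemma lspan_sub1 s u w : lspan [:: u] w -> lspan s u -> lspan s w.
Proof. by move=> + su; apply: lspan_sub => y; rewrite !inE => /eqP ->. Qed.

Lemma lspan_sub2 s u v w : lspan [:: u; v] w -> lspan s u -> lspan s v -> lspan s w.
Proof. by move=> + su sv; apply: lspan_sub => y; rewrite !inE => /orP[] /eqP ->. Qed.

Lemma lspan_sub3 s u v w z : lspan [:: u; v; w] z ->
  lspan s u -> lspan s v -> lspan s w -> lspan s z.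
Proof. by move=> + su sv sw; apply: lspan_sub => y; rewrite !inE => /or3P[] /eqP ->. Qed.

Lemma lspan_exchange u s w : lspan (u :: s) w -> ~ lspan s w -> lspan (w :: s) u.
Proof.
move=> [a wa] nw; have a0 : a != 0.
  by apply/eqP => a0; apply: nw; rewrite a0 scale0r subr0 in wa.
have au := F_skew a0.
exists a^-1; rewrite -[u in X in lspan _ X](scale1r u) -(mulVr au) -scalerA -scalerBr -opprB.
exact/lspanZ/lspanN.
Qed.

Lemma lspan1 u w : lspan [:: u] w -> exists a, w = a *: u.
Proof. by move=> [a /= /eqP]; rewrite subr_eq0 => /eqP ->; exists a. Qed.

Lemma lspan2 u v w : lspan [:: u; v] w -> exists a b, w = a *: u + b *: v.
Proof.
move=> [a /lspan1[b E]]; exists a, b; by rewrite -E addrC subrK.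
Qed.

Lemma lspan3 u v w z : lspan [:: u; v; w] z -> exists a b c, z = a *: u + b *: v + c *: w.
Proof.
move=> [a /lspan2[b [c E]]]; exists a, b, c; by rewrite -addrA -E addrC subrK.
Qed.

(** Two exchanges put [w] and [w'] in the place of [u] and [v], with [v] going first if [w] is a
    multiple of it. Projectively, a line is determined by any two of its points. *)
Lemma lspan_plane u v w w' : lspan [:: u; v] w -> lspan [:: u; v] w' ->
  w != 0 -> ~ lspan [:: w] w' -> lspan [:: w; w'] u /\ lspan [:: w; w'] v.
Proof.
move=> sw sw' w0 nw'.
have wh : lspan [:: w; w'] w by exact: lspan_head.
have wh' : lspan [:: w; w'] w' by apply/lspan_cons/lspan_head.
have [wv|nwv] := classic (lspan [:: v] w).
  have vw : lspan [:: w] v by apply: lspan_exchange => //; apply/eqP.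
  split; last exact: lspan_sub1 vw _.
  suff uw : lspan [:: w'; w] u by exact: lspan_sub2 uw _ _.
  apply: lspan_exchange => //; apply: (lspan_sub2 sw'); first exact: lspan_head.
  exact: lspan_cons.
have uw : lspan [:: w; v] u by apply: lspan_exchange.
have vw : lspan [:: w'; w] v.
  apply: lspan_exchange => //; apply: (lspan_sub2 sw'); last exact: lspan_head.
  by apply: (lspan_sub2 uw); apply: lspan_mem; rewrite !inE eqxx ?orbT.
have {}vw : lspan [:: w; w'] v by exact: lspan_sub2 vw _ _.
by split=> //; exact: lspan_sub2 uw _ _.
Qed.

Lemma skew_scaler_eq0 (a : F) w : a *: w = 0 -> a != 0 -> w = 0.
Proof. by move=> E /F_skew au; rewrite -(scale1r w) -(mulVr au) -scalerA E scaler0. Qed.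
End LinearSpan.

(** The hypothesis on monomorphisms speaks of bundled morphisms, whereas the scalar map below is
    obtained by choice. *)
Lemma rmorphism_exists (R S : nzRingType) (f : R -> S) :
  {morph f : x y / x + y} -> f 1 = 1 -> {morph f : x y / x * y} ->
  exists g : {rmorphism R -> S}, g =1 f.
Proof.
move=> fD f1 fM.
have fB : zmod_morphism f.
  move=> x y; apply: (addIr (f y)); by rewrite subrK -fD subrK.
pose a := GRing.isZmodMorphism.Build R S f fB.
pose m := GRing.isMonoidMorphism.Build R S f (conj f1 fM).
pose g : {rmorphism R -> S} := HB.pack f a m.
by exists g.
Qed.

(** * Semilinearity of full embeddings *)

Section Semilinear.
Variables (F F' : unitRingType) (V : lmodType F) (W : lmodType F') (h : V -> W).
Hypothesis F_skew : skew_field F.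
Hypothesis F'_skew : skew_field F'.
Hypothesis h_line : forall x y t, lspan [:: h x; h y] (h (x + t *: (y - x))).
Hypothesis h_reflect : forall x y z, x != y -> lspan [:: h x; h y] (h z) ->
  exists t, z = x + t *: (y - x).
Hypothesis h_neq0 : forall x, h x != 0.
Hypothesis h_proj_inj : forall x y, lspan [:: h x] (h y) -> y = x.
Hypothesis h_dim : forall x y z, exists u, ~ lspan [:: h x; h y; h z] (h u).
Hypothesis F_big : exists t : F, t != 0 /\ t != 1.
Hypothesis V_big : forall v : V, exists y, forall t, y <> t *: v.

(** [h] provides homogeneous coordinates: up to left scalars, nonzero vectors of [W] are points of
    the projective closure of the target. For nonzero [v], [image_line x v] is the projective line
    that contains the images of all points [x + t *: v]. *)
Let image_line x v := lspan [:: h x; h (x + v)].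
Let off_line (x v y : V) := forall t : F, y <> x + t *: v.

Ltac in_span := by apply: lspan_mem; rewrite !inE eqxx ?orbT.

Lemma image_line_in x v t : image_line x v (h (x + t *: v)).
Proof. by have := h_line x (x + v) t; rewrite [x + v - x]addrC addKr. Qed.

Lemma image_line_reflect x v y : v != 0 -> image_line x v (h y) -> exists t, y = x + t *: v.
Proof.
move=> v0 /h_reflect[|t ->]; last by exists t; rewrite [x + v]addrC addrK.
by apply/eqP => E; case/eqP: v0; apply: (addrI x); rewrite -E addr0.
Qed.

Lemma off_line_image x v y : v != 0 -> off_line x v y -> ~ image_line x v (h y).
Proof. by move=> v0 off /(image_line_reflect v0)[t]; exact: off. Qed.

Lemma off_line_sym x v y : off_line x v y -> off_line y v x.
Proof. by move=> off t E; apply: (off (- t)); rewrite E scaleNr addrK. Qed.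

Lemma off_line_exists x v : exists y, off_line x v y.
Proof.
have [y yP] := V_big v; exists (x + y) => t /addrI; exact: yP.
Qed.

(** [y + v] lies on a transversal joining a point [r] of the line [xy] to a point [s] of the line
    through [x] in direction [v]. A scalar other than 0 and 1 makes such a transversal available. *)
Lemma image_coplanar x v y : lspan [:: h x; h (x + v); h y] (h (y + v)).
Proof.
have [t [t0 t1]] := F_big; have tu := F_skew t0.
(* Comparing the multiples of [y - x] in [y + v = r + b *: (s - r)] demands [(1 - b) * t = 1]; those
   of [v] then fix [s]. *)
pose b := 1 - t^-1.
have b0 : b != 0.
  by rewrite subr_eq0 eq_sym; apply: contra t1 => /eqP E; rewrite -[t]invrK E invr1.
have bu := F_skew b0.
pose r := x + t *: (y - x); pose s := x + b^-1 *: v.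
have qE : y + v = r + b *: (s - r).
  have yE : y = x + (y - x) by rewrite addrC subrK.
  have -> : b *: (s - r) = v + (- (t *: (y - x)) + (y - x)).
    rewrite /s /r opprD addrACA subrr add0r scalerBr !scalerA mulrV // scale1r.
    by rewrite mulrBl mul1r mulVr // scalerBl scale1r opprB [_ - t *: _]addrC.
  rewrite /r; move: (y - x) yE => d ->; rewrite -!addrA; congr (x + _).
  by rewrite [v + _]addrCA !addrA addrN add0r addrC.
have rx := h_line x y t; have sx := image_line_in x v b^-1.
rewrite qE; apply: (lspan_sub2 (h_line r s b)).
  by apply: (lspan_sub2 rx); in_span.
by apply: (lspan_sub2 sx); in_span.
Qed.

Lemma image_lines_meet x v y : v != 0 -> off_line x v y ->
  exists w, [/\ w != 0, image_line x v w & image_line y v w].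
Proof.
move=> v0 off; have [a [b [c E]]] := lspan3 (image_coplanar x v y).
exists (a *: h x + b *: h (x + v)); split.
- apply/eqP => E0; rewrite E0 add0r in E; case/eqP: v0; apply: (addrI y); rewrite addr0.
  by apply: h_proj_inj; rewrite E; apply/lspanZ/lspan_head.
- by apply: lspanD; apply: lspanZ; in_span.
have -> : a *: h x + b *: h (x + v) = h (y + v) - c *: h y by rewrite E addrK.
by apply: lspanB; [|apply: lspanZ]; in_span.
Qed.

Lemma image_lines_meet_unique x v y w w' : v != 0 -> off_line x v y ->
  w != 0 -> image_line x v w -> image_line y v w ->
  image_line x v w' -> image_line y v w' -> lspan [:: w] w'.
Proof.
move=> v0 off w0 xw yw xw' yw'; apply: NNPP => nw.
have [hx _] := lspan_plane F'_skew xw xw' w0 nw.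
apply: (off_line_image v0 (off_line_sym off)).
exact: lspan_sub2 hx yw yw'.
Qed.

(** Three lines that meet in pairs and do not lie in one plane concur: if the third met the first
    two in different points [w1] and [w2], it would lie in their plane. *)
Lemma image_lines_concurrent_off x v y w z : v != 0 -> off_line x v y ->
  w != 0 -> image_line x v w -> image_line y v w ->
  ~ lspan [:: h x; h (x + v); h y] (h z) -> image_line z v w.
Proof.
move=> v0 offy w0 xw yw nz.
have subx u : image_line x v u -> lspan [:: h x; h (x + v); h y] u.
  by move=> xu; apply: (lspan_sub2 xu); in_span.
have suby u : image_line y v u -> lspan [:: h x; h (x + v); h y] u.
  by move=> yu; apply: (lspan_sub2 yu); [in_span|exact: image_coplanar].
have offxz : off_line x v z by move=> t E; apply: nz; apply: subx; rewrite E; exact: image_line_in.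
have offyz : off_line y v z by move=> t E; apply: nz; apply: suby; rewrite E; exact: image_line_in.
have [w1 [w10 xw1 zw1]] := image_lines_meet v0 offxz.
have [w2 [w20 yw2 zw2]] := image_lines_meet v0 offyz.
have [w12|nw12] := classic (lspan [:: w1] w2); last first.
  have [hz _] := lspan_plane F'_skew zw1 zw2 w10 nw12.
  by case: nz; apply: (lspan_sub2 hz); [exact: subx|exact: suby].
have w21 : lspan [:: w2] w1.
  by apply: lspan_exchange => //; apply/eqP.
have yw1 : image_line y v w1 by exact: lspan_sub1 w21 yw2.
by apply: (lspan_sub1 (image_lines_meet_unique v0 offy w10 xw1 yw1 xw yw)).
Qed.

Lemma image_lines_concurrent x v y w : v != 0 -> off_line x v y ->
  w != 0 -> image_line x v w -> image_line y v w -> forall z, image_line z v w.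
Proof.
move=> v0 offy w0 xw yw z.
have [hz|] := classic (lspan [:: h x; h (x + v); h y] (h z)); last first.
  exact: image_lines_concurrent_off.
have [[t zE]|offz] := classic (exists t, z = x + t *: v).
  have xE : x = z + (- t) *: v by rewrite zE scaleNr addrK.
  apply: (lspan_sub2 xw); first by rewrite xE; exact: image_line_in.
  have -> : x + v = z + (1 - t) *: v.
    by rewrite zE scalerBl scale1r -addrA; congr (x + _); rewrite addrC subrK.
  exact: image_line_in.
have {}offz : off_line x v z by move=> t E; apply: offz; exists t.
(* For [h z] in the plane of the first two lines, an auxiliary [u] with image outside it takes the
   role of [y]: the plane of [h x], [h (x + v)] and [h u] does not contain [h z]. *)
have [u nu] := h_dim x (x + v) y.
have uw := image_lines_concurrent_off v0 offy w0 xw yw nu.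
have offu : off_line x v u.
  move=> t E; apply: nu; rewrite E; apply: (lspan_sub2 (image_line_in x v t)); in_span.
apply: (image_lines_concurrent_off v0 offu w0 xw uw) => hz'; apply: nu.
have rot : lspan [:: h z; h x; h (x + v)] (h u).
  apply: lspan_exchange => //; last exact: off_line_image.
  by apply: (lspan_sub3 hz'); in_span.
by apply: (lspan_sub3 rot) => //; in_span.
Qed.

(** [w] is the common point of the images of a parallel class. It is not an image point, as that
    would lie on the images of two disjoint lines. The scaling, which puts [w + h 0] at the image of
    [v], is what makes the choice additive. *)
Lemma direction_vector_exists v : v != 0 -> exists w mu, [/\ forall z, image_line z v w,
  forall z a, w <> a *: h z & w + h 0 = mu *: h v].
Proof.
move=> v0; have [y offy] := off_line_exists 0 v.
have [w [w0 xw yw]] := image_lines_meet v0 offy.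
have allw := image_lines_concurrent v0 offy w0 xw yw.
have nw z a : w <> a *: h z.
  move=> E; have a0 : a != 0 by apply: contraNneq w0 => a0; rewrite E a0 scale0r.
  have [y' offy'] := off_line_exists z v.
  apply: (off_line_image v0 (off_line_sym offy')).
  have -> : h z = a^-1 *: w by rewrite E scalerA mulVr ?F'_skew ?scale1r.
  exact: lspanZ (allw _).
have [a [b wE]] := lspan2 (allw 0); rewrite add0r in wE.
have a0 : a != 0.
  by apply/eqP => a0; apply: (nw v b); rewrite wE a0 scale0r add0r.
have au := F'_skew a0.
exists (- a^-1 *: w), (- a^-1 * b); split.
- by move=> z; exact: lspanZ (allw z).
- move=> z c E; apply: (nw z (- a * c)); rewrite -scalerA -E scalerA mulrNN mulrV //.
  by rewrite scale1r.
by rewrite wE scalerDr !scalerA mulNr mulVr // scaleN1r addrAC addNr add0r.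
Qed.

Lemma direction_map_exists : exists c : V -> W,
  [/\ c 0 = 0, forall v z, image_line z v (c v),
      forall v z a, v != 0 -> c v <> a *: h z &
      forall v, exists mu, c v + h 0 = mu *: h v].
Proof.
have [c cP] : exists c : V -> W, forall v, [/\ v = 0 -> c v = 0, forall z, image_line z v (c v),
    v != 0 -> forall z a, c v <> a *: h z & exists mu, c v + h 0 = mu *: h v].
  apply: (choice (fun v w => [/\ v = 0 -> w = 0, forall z, image_line z v w,
    v != 0 -> forall z a, w <> a *: h z & exists mu, w + h 0 = mu *: h v])) => v.
  have [->|v0] := eqVneq v 0.
    exists 0; split=> // [z|]; first exact: lspan0.
    by exists 1; rewrite add0r scale1r.
  have [w [mu [wl woff wE]]] := direction_vector_exists v0.
  by exists w; split=> // [E|]; [rewrite E eqxx in v0|exists mu].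
exists c; split=> [|v z|v z a v0|v].
- by have [c0 _ _ _] := cP 0; exact: c0.
- by have [_ cl _ _] := cP v.
- by have [_ _ coff _] := cP v; exact: coff.
- by have [_ _ _ ca] := cP v.
Qed.

(** * Additivity and semilinearity of the direction map *)

Section DirectionMap.
Variable c : V -> W.
Hypothesis c0 : c 0 = 0.
Hypothesis c_line : forall v z, image_line z v (c v).
Hypothesis c_off : forall v z a, v != 0 -> c v <> a *: h z.
Hypothesis c_affine : forall v, exists mu, c v + h 0 = mu *: h v.

Let independent2 (x y : V) := x != 0 /\ forall t : F, y <> t *: x.

Lemma independent2_neq0 x y : independent2 x y -> y != 0.
Proof. by move=> [_ xy]; apply/eqP => y0; apply: (xy 0); rewrite scale0r. Qed.

Lemma independent2_off x y : independent2 x y -> off_line 0 x y.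
Proof. by move=> [_ xy] t; rewrite add0r. Qed.

Lemma direction_neq0 v : v != 0 -> c v != 0.
Proof.
move=> v0; apply/eqP => E.
by apply: (c_off (v := v) (z := 0) (a := 0)) => //; rewrite scale0r.
Qed.

Lemma translate_in_span z v : lspan [:: h z; c v] (h (z + v)).
Proof.
have [->|v0] := eqVneq v 0; first by rewrite addr0; exact: lspan_head.
suff : lspan [:: c v; h z] (h (z + v)) by move=> H; apply: (lspan_sub2 H); in_span.
apply: lspan_exchange => //; last by move=> /lspan1[a]; exact: c_off.
by apply: (lspan_sub2 (c_line v z)); in_span.
Qed.

Lemma direction_in_span v : lspan [:: h 0; h v] (c v).
Proof. by have := c_line v 0; rewrite /image_line add0r. Qed.

Lemma image_in_span v : lspan [:: h 0; c v] (h v).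
Proof. by have := translate_in_span 0 v; rewrite add0r. Qed.

Lemma image_independent x y : independent2 x y -> ~ lspan [:: h 0; h x] (h y).
Proof.
move=> xy; have [x0 _] := xy.
have := off_line_image x0 (independent2_off xy); by rewrite /image_line add0r.
Qed.

Lemma direction_independent x y : independent2 x y -> ~ lspan [:: c x] (c y).
Proof.
move=> xy H; apply: (image_independent xy).
apply: (lspan_sub2 (image_in_span y)); first in_span.
exact: lspan_sub1 H (direction_in_span x).
Qed.

(** Otherwise the line of [c x] and [c y] would contain [h 0] and [h x], hence be the line joining
    them; but it would contain [h y] as well. *)
Lemma origin_independent x y : independent2 x y -> ~ lspan [:: c x; c y] (h 0).
Proof.
move=> xy H0; have [x0 _] := xy.
have Hx : lspan [:: c x; c y] (h x) by apply: (lspan_sub2 (image_in_span x)) => //; in_span.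
have Hy : lspan [:: c x; c y] (h y) by apply: (lspan_sub2 (image_in_span y)) => //; in_span.
have nx : ~ lspan [:: h 0] (h x) by move/h_proj_inj => E; rewrite E eqxx in x0.
have [cx cy] := lspan_plane F'_skew H0 Hx (h_neq0 0) nx.
by apply: (image_independent xy); exact: lspan_sub2 Hy cx cy.
Qed.

(* Two parallel planes with different images meet at infinity in a line, which
   contains the three direction points. *)
Lemma direction_sum_in_span x y : independent2 x y -> lspan [:: c x; c y] (c (x + y)).
Proof.
move=> xy; have [z nz] := h_dim 0 x y; apply: NNPP => H; apply: nz.
have Hz : lspan [:: h z; c x; c y] (c (x + y)).
  apply: (lspan_sub2 (c_line (x + y) z)); first in_span.
  rewrite addrA; apply: (lspan_sub2 (translate_in_span (z + x) y)); last in_span.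
  by apply: (lspan_sub2 (translate_in_span z x)); in_span.
have Hcx : lspan [:: h 0; h x; h y] (c x) by apply: (lspan_sub2 (direction_in_span x)); in_span.
have Hcy : lspan [:: h 0; h x; h y] (c y) by apply: (lspan_sub2 (direction_in_span y)); in_span.
apply: (lspan_sub3 (lspan_exchange F'_skew Hz H)) => //.
apply: (lspan_sub2 (direction_in_span (x + y))); first in_span.
by apply: (lspan_sub2 (translate_in_span x y)); [in_span|].
Qed.

(** The vector [e = c x + c y + h 0] lies on the lines from [h x] to [c y] and from [h y] to [c x],
    which meet in [h (x + y)]. So [c (x + y) + h 0] is a multiple [r *: e], and comparing the terms
    in [h 0] modulo [c x] and [c y] gives [r = 1]. *)
Lemma direction_add_independent x y : independent2 x y -> c (x + y) = c x + c y.
Proof.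
move=> xy; have [x0 _] := xy; have y0 := independent2_neq0 xy.
pose e := c x + c y + h 0.
have nh0 := origin_independent xy.
have [mx mxE] := c_affine x; have [my myE] := c_affine y; have [m mE] := c_affine (x + y).
have ex : lspan [:: h x; c y] e.
  by rewrite /e addrAC mxE; apply: lspanD; [apply: lspanZ|]; in_span.
have ey : lspan [:: h y; c x] e.
  by rewrite /e -addrA myE; apply: lspanD; [|apply: lspanZ]; in_span.
have hy : lspan [:: h y; c x] (h (x + y)) by rewrite addrC; exact: translate_in_span.
have [k eE] : exists k, e = k *: h (x + y).
  apply: lspan1; apply: NNPP => ne.
  have [hx _] := lspan_plane F'_skew (translate_in_span x y) ex (h_neq0 _) ne.
  have {}hx : lspan [:: h y; c x] (h x) by exact: lspan_sub2 hx hy ey.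
  have nhx : ~ lspan [:: c x] (h x).
    move=> /lspan1[a E]; have a0 : a != 0.
      by apply/eqP => a0; case/eqP: (h_neq0 x); rewrite E a0 scale0r.
    apply: (c_off (v := x) (z := x) (a := a^-1)) => //.
    by rewrite E scalerA mulVr ?F'_skew ?scale1r.
  apply: (image_independent xy).
  apply: (lspan_sub2 (lspan_exchange F'_skew hx nhx)); first in_span.
  exact: direction_in_span.
have k0 : k != 0.
  apply/eqP => k0; apply: nh0; have -> : h 0 = - (c x + c y).
    by apply/eqP; rewrite -addr_eq0 addrC -/e eE k0 scale0r.
  by apply: lspanN; apply: lspanD; in_span.
pose r := m * k^-1.
have cE : c (x + y) + h 0 = r *: e by rewrite mE eE scalerA mulrVK ?F'_skew.
have r1 : r = 1.
  apply/eqP; rewrite -subr_eq0; apply/negPn/negP => r1; apply: nh0.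
  have -> : h 0 = (r - 1)^-1 *: (c (x + y) - r *: (c x + c y)).
    have -> : c (x + y) = r *: (c x + c y) + (r - 1) *: h 0.
      by apply: (addIr (h 0)); rewrite cE /e scalerDr scalerBl scale1r -addrA subrK.
    rewrite [_ - r *: _]addrC addKr.
    by rewrite scalerA mulVr ?F'_skew ?scale1r.
  apply: lspanZ; apply: lspanB; first exact: direction_sum_in_span.
  by apply: lspanZ; apply: lspanD; in_span.
by apply: (addIr (h 0)); rewrite cE r1 scale1r.
Qed.

Lemma direction_add x y : c (x + y) = c x + c y.
Proof.
have [->|x0] := eqVneq x 0; first by rewrite add0r c0 add0r.
have [->|y0] := eqVneq y 0; first by rewrite addr0 c0 addr0.
have [[t yE]|nxy] := classic (exists t, y = t *: x); last first.
  by apply: direction_add_independent; split=> // t E; apply: nxy; exists t.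
(* For dependent [x] and [y], a vector [z] off their line reduces the claim to independent pairs, by
   [c (x + y) + c z = c x + c (y + z)]. *)
have [z zx] := V_big x.
have zshift a : forall t, z + a *: x <> t *: x.
  by move=> s E; apply: (zx (s - a)); rewrite scalerBl -E addrK.
have zmul b : b *: x != 0 -> independent2 (b *: x) z.
  by move=> b0; split=> // s; rewrite scalerA; exact: zx.
(* If the sum is 0, the pair [x + y], [z] is not independent, and the detour runs through
   [z - x]. *)
have [xy0|xy0] := eqVneq (x + y) 0.
  have yN : y = - x by apply/eqP; rewrite -addr_eq0 addrC xy0.
  have E1 : c z = c x + c (z - x).
    rewrite -direction_add_independent; first by rewrite addrC subrK.
    by split=> //; rewrite -scaleN1r; exact: zshift.
  have E2 : c (z - x) = c y + c z.
    by rewrite -direction_add_independent ?yN 1?addrC // -yN yE; apply: zmul; rewrite -yE.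
  by rewrite xy0 c0; apply: (addIr (c z)); rewrite -addrA -E2 -E1 add0r.
apply: (addIr (c z)); rewrite -addrA.
have xyE : x + y = (1 + t) *: x by rewrite scalerDl scale1r -yE.
rewrite -direction_add_independent; last by rewrite xyE; apply: zmul; rewrite -xyE.
rewrite -direction_add_independent; last by rewrite yE; apply: zmul; rewrite -yE.
rewrite -direction_add_independent ?addrA //.
by split=> //; rewrite addrC yE; exact: zshift.
Qed.

(** [c (t *: x)] lies on the images of all lines with direction [x], and two of these have only the
    point [c x] in common. *)
Lemma direction_scale_exists x t : x != 0 -> exists s, c (t *: x) = s *: c x.
Proof.
move=> x0; apply: lspan1.
have [y offy] := off_line_exists 0 x.
have cl z : image_line z x (c (t *: x)).
  apply: (lspan_sub2 (c_line (t *: x) z)); last exact: image_line_in.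
  in_span.
exact: image_lines_meet_unique offy (direction_neq0 x0) _ _ _ _.
Qed.

Lemma direction_scale_independent x y t s : independent2 x y ->
  c (t *: x) = s *: c x -> c (t *: y) = s *: c y.
Proof.
move=> xy xE; have [x0 _] := xy; have y0 := independent2_neq0 xy.
have xy0 : x + y != 0.
  by apply/eqP => E; apply: (xy.2 (-1)); rewrite scaleN1r; apply/eqP; rewrite -addr_eq0 addrC E.
have [s' yE] := direction_scale_exists t y0.
have [r rE] := direction_scale_exists t xy0.
move: rE; rewrite scalerDr !direction_add xE yE scalerDr => E.
have {}E : (s - r) *: c x = (r - s') *: c y.
  rewrite !scalerBl; apply/eqP; rewrite subr_eq addrAC eq_sym subr_eq addrC.
  by rewrite -E addrC.
have rs' : r = s'.
  apply/eqP; rewrite -subr_eq0; apply/negPn/negP => n0; apply: (direction_independent xy).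
  have -> : c y = (r - s')^-1 *: ((s - r) *: c x) by rewrite E scalerA mulVr ?F'_skew ?scale1r.
  by apply/lspanZ/lspanZ/lspan_head.
rewrite rs' subrr scale0r in E.
have [/eqP|sr] := eqVneq (s - s') 0; first by rewrite subr_eq0 => /eqP ->.
by have /eqP := skew_scaler_eq0 F'_skew E sr; rewrite (negPf (direction_neq0 x0)).
Qed.

Lemma direction_semilinear :
  exists g : {rmorphism F -> F'}, forall t x, c (t *: x) = g t *: c x.
Proof.
have [x0 x0P] := V_big 0.
have x0n : x0 != 0 by apply/eqP => E; apply: (x0P 0); rewrite scaler0.
have [f fP] := choice _ (fun t => direction_scale_exists t x0n).
have [z zx] := V_big x0.
have fE t x : c (t *: x) = f t *: c x.
  have [->|xn] := eqVneq x 0; first by rewrite scaler0 c0 scaler0.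
  have [[r xE]|nx] := classic (exists s, x = s *: x0); last first.
    apply: (@direction_scale_independent x0 x) => //; split=> // s E.
    by apply: nx; exists s.
  (* A nonzero multiple of [x0] is independent of [z], so the factor travels from [x0] to [z] and
     from there to [x]. *)
  apply: (@direction_scale_independent z x).
    split=> [|s E]; first by apply/eqP => E; apply: (zx 0); rewrite E scale0r.
    have s0 : s != 0 by apply: contraNneq xn => s0; rewrite E s0 scale0r.
    by apply: (zx (s^-1 * r)); rewrite -scalerA -xE E scalerA mulVr ?F_skew ?scale1r.
  by apply: (@direction_scale_independent x0 z).
have inj a b : a *: c x0 = b *: c x0 -> a = b.
  move=> E; apply/eqP; rewrite -subr_eq0; apply/negPn/negP => n0.
  have E0 : (a - b) *: c x0 = 0 by rewrite scalerBl E subrr.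
  by have /eqP := skew_scaler_eq0 F'_skew E0 n0; rewrite (negPf (direction_neq0 x0n)).
have [|||g gE] := @rmorphism_exists F F' f.
- by move=> a b; apply: inj; rewrite -fP !scalerDl direction_add !fP.
- by apply: inj; rewrite -fP !scale1r.
- by move=> a b; apply: inj; rewrite -fP -scalerA fE fP scalerA.
by exists g => t x; rewrite gE.
Qed.
End DirectionMap.

Lemma semilinear_lift : exists (c : V -> W) (g : {rmorphism F -> F'}),
  [/\ {morph c : x y / x + y}, forall t x, c (t *: x) = g t *: c x &
      forall x, exists mu, mu != 0 /\ c x + h 0 = mu *: h x].
Proof.
have [c [c0 cl coff ca]] := direction_map_exists.
have [g gE] := direction_semilinear c0 cl coff ca.
exists c, g; split=> // [x y|x]; first exact: direction_add.
have [mu muE] := ca x; exists mu; split=> //; apply/eqP => mu0.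
have E : c x = - h 0 by apply/eqP; rewrite -addr_eq0 muE mu0 scale0r.
have [x0|xn] := eqVneq x 0.
  by case/eqP: (h_neq0 0); apply/eqP; rewrite -oppr_eq0 -E x0 c0.
by apply: (coff x 0 (-1) xn); rewrite scaleN1r.
Qed.
End Semilinear.

(** * Coordinates *)

Section Coordinates.
Variables (A : affine_space) (F : unitRingType) (V : lmodType F) (f : point A -> V).
Hypothesis f_coord : coordinatization f.

Lemma coordinatization_line p q r l : p <> q -> inc p l -> inc q l ->
  inc r l <-> exists t, f r = f p + t *: (f q - f p).
Proof.
have [sF [/bij_inj fI [fl _]]] := f_coord.
move=> pq pl ql; have [a [v [v0 lE]]] := fl l.
have [s sE] : exists s, f p = a + s *: v by apply/lE; exists p.
have [s' s'E] : exists s, f q = a + s *: v by apply/lE; exists q.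
have dE : f q - f p = (s' - s) *: v by rewrite sE s'E opprD addrACA subrr add0r scalerBl.
have su : s' - s \is a GRing.unit.
  by apply: sF; rewrite subr_eq0; apply/eqP => E; apply: pq; apply: fI; rewrite sE s'E E.
rewrite dE sE; split=> [rl|[t rE]].
  have [s2 s2E] : exists s, f r = a + s *: v by apply/lE; exists r.
  exists ((s2 - s) * (s' - s)^-1).
  by rewrite s2E scalerA mulrVK // -addrA -scalerDl [s + _]addrC subrK.
have [r' [r'l /fI <-]] : exists p, inc p l /\ f p = f r; last by [].
by apply/lE; exists (s + t * (s' - s)); rewrite rE scalerA scalerDl addrA.
Qed.

Lemma coordinatization_translate S p q x y t : subspace S -> S p -> S q -> S x ->
  f y = f x + t *: (f q - f p) -> S y.
Proof.
have [sF [/bij_inj fI [_ [_ fpar]]]] := f_coord.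
move=> [Sl Sp] ap aq ax yE.
have [E|pq] := classic (p = q).
  by rewrite E subrr scaler0 addr0 in yE; rewrite (fI _ _ yE).
have [l [pl ql]] := ax_join pq.
have [m [xm ml]] := ax_euclid x l.
have lS : forall z, inc z l -> S z by exact: (Sl p q).
apply: (Sp l m x) => //.
have /fpar[a [b [v [[v0 mE] [_ lE]]]]] := ml.
have [s sE] : exists s, f p = b + s *: v by apply/lE; exists p.
have [s' s'E] : exists s, f q = b + s *: v by apply/lE; exists q.
have [s2 s2E] : exists s, f x = a + s *: v by apply/mE; exists x.
have [y' [y'm /fI <-]] : exists p, inc p m /\ f p = f y; last by [].
apply/mE; exists (s2 + t * (s' - s)).
by rewrite yE sE s'E s2E opprD addrACA subrr add0r -scalerBl scalerA scalerDl addrA.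
Qed.

Lemma coordinatization_plane S p q r x a b : subspace S -> S p -> S q -> S r ->
  f x = f p + a *: (f q - f p) + b *: (f r - f p) -> S x.
Proof.
move=> sS ap aq ar xE; have [_ [[g fK gK] _]] := f_coord.
apply: (@coordinatization_translate _ p r (g (f p + a *: (f q - f p))) _ b) => //;
  last by rewrite gK.
by apply: (@coordinatization_translate _ p q p _ a) => //; rewrite gK.
Qed.
End Coordinates.

(** * Surjectivity when all monomorphisms of the coordinate fields are onto *)

Section CoordinateSurjectivity.
Variables (A A' : affine_space) (phi : line A -> line A') (lam : point A -> point A').
Hypothesis phi_bij : bijective phi.
Hypothesis lam_inj : injective lam.
Hypothesis lam_incE : forall p l, inc (lam p) (phi l) <-> inc p l.
Hypothesis pencil : exists (x : point A) l m, [/\ l <> m, inc x l & inc x m].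
Hypothesis A_big : ~ order_two A.
Hypothesis dim_A' : dim_ge A' 3.
Variables (F F' : unitRingType) (V : lmodType F) (V' : lmodType F').
Variables (f : point A -> V) (f' : point A' -> V').
Hypothesis f_coord : coordinatization f.
Hypothesis f'_coord : coordinatization f'.

Lemma coordinates_big : exists t : F, t != 0 /\ t != 1.
Proof.
have [x [l [_ [_ xl _]]]] := pencil.
have [y [yx yl]] := other_point x l.
have [r [rl rx ry]] := third_point A_big x y l.
have [_ [/bij_inj fI _]] := f_coord.
have [t tE] := (coordinatization_line f_coord r (not_eq_sym yx) xl yl).1 rl.
exists t; split; apply/eqP => t01; rewrite t01 in tE.
  by apply: rx; apply: fI; rewrite tE scale0r addr0.
by apply: ry; apply: fI; rewrite tE scale1r addrC subrK.
Qed.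

Lemma coordinates_off_line (v : V) : exists y, forall t, y <> t *: v.
Proof.
have [x [l [m [lm xl xm]]]] := pencil.
have [sF [/bij_inj fI _]] := f_coord.
have [p [px pl]] := other_point x l; have [q [qx qm]] := other_point x m.
apply: NNPP => H.
have all_v y : exists t, y = t *: v.
  by apply: NNPP => H'; apply: H; exists y => t E; apply: H'; exists t.
have [s sE] := all_v (f p - f x); have [s' s'E] := all_v (f q - f x).
have su : s \is a GRing.unit.
  apply: sF; apply/eqP => s0; apply: px; apply: fI; apply/eqP.
  by rewrite -subr_eq0 sE s0 scale0r.
apply: lm; apply: (ax_join_uniq qx) => //.
apply/(coordinatization_line f_coord q (not_eq_sym px) xl pl).
exists (s' * s^-1); by rewrite sE scalerA mulrVK // -s'E addrC subrK.
Qed.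

Lemma coordinates_surj :
  (forall g : {rmorphism F -> F'}, injective g -> forall y, exists x, g x = y) ->
  forall P, exists p, lam p = P.
Proof.
move=> mono_onto P.
have [sF [[g fK gK] _]] := f_coord; have fI := can_inj fK; have gI := can_inj gK.
have [sF' [[g' f'K g'K] _]] := f'_coord; have f'I := can_inj f'K.
(* Homogeneous coordinates of [A']: the last one is 1 for the chosen representatives of points, and
   0 at infinity. *)
pose W : lmodType F' := (V' * F'^o)%type.
pose h (x : V) : W := (f' (lam (g x)), 1).
have neq x y : x != y -> g x <> g y by move=> /eqP xy /gI.
have h_neq0 x : h x != 0 by apply/eqP => -[_ /eqP]; rewrite oner_eq0.
have h_line x y t : lspan [:: h x; h y] (h (x + t *: (y - x))).
  have [->|xy] := eqVneq x y; first by rewrite subrr scaler0 addr0; exact: lspan_head.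
  have [l [xl yl]] := ax_join (neq _ _ xy).
  set z := x + _.
  have zl : inc (g z) l.
    by apply/(coordinatization_line f_coord _ (neq _ _ xy) xl yl); exists t; rewrite !gK.
  have lxy : lam (g x) <> lam (g y) by move/lam_inj/gI/eqP; rewrite (negPf xy).
  have [s sE] := (coordinatization_line f'_coord (lam (g z)) lxy
    ((lam_incE _ _).2 xl) ((lam_incE _ _).2 yl)).1 ((lam_incE _ _).2 zl).
  have -> : h z = h x + s *: (h y - h x).
    by apply/pair_equal_spec; rewrite /= sE subrr scaler0 addr0.
  apply: lspanD; first exact: lspan_head.
  by apply: lspanZ; apply: lspanB; apply: lspan_mem; rewrite !inE eqxx ?orbT.
have h_reflect x y z : x != y -> lspan [:: h x; h y] (h z) -> exists t, z = x + t *: (y - x).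
  move=> xy /lspan2[a [b [zE ab]]].
  have [l [xl yl]] := ax_join (neq _ _ xy).
  have lxy : lam (g x) <> lam (g y) by move/lam_inj/gI/eqP; rewrite (negPf xy).
  have zl : inc (g z) l.
    apply/lam_incE; apply/(coordinatization_line f'_coord _ lxy);
      [by apply/lam_incE|by apply/lam_incE|].
    have {}ab : 1 = a * 1 + b * 1 := ab; rewrite !mulr1 in ab.
    exists b; rewrite zE; have -> : a = 1 - b by rewrite ab addrK.
    by rewrite scalerBl scale1r scalerBr addrAC addrA.
  have [t tE] := (coordinatization_line f_coord _ (neq _ _ xy) xl yl).1 zl.
  by exists t; rewrite !gK in tE.
have h_proj_inj x y : lspan [:: h x] (h y) -> y = x.
  move=> /lspan1[a [yE a1]]; apply/gI/lam_inj/f'I; rewrite yE.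
  by have {}a1 : 1 = a * 1 := a1; rewrite mulr1 in a1; rewrite -a1 scale1r.
(* Otherwise three points would generate all image points, hence [A'], which has four independent
   points. The last coordinate turns linear combinations into affine ones. *)
have h_dim x y z : exists u, ~ lspan [:: h x; h y; h z] (h u).
  apply: NNPP => H.
  have allu u : lspan [:: h x; h y; h z] (h u) by apply: NNPP => ?; apply: H; exists u.
  pose Y := [:: lam (g x); lam (g y); lam (g z)].
  have [u [ind su]] := (dim_geP A' 3).1 dim_A'.
  suff : (size u <= size Y)%N by rewrite su.
  apply: (steinitz ind) => Q _.
  apply: (image_generates phi_bij lam_inj lam_incE pencil (span_subspace _)) => p.
  have [a [b [c [pE abc]]]] := lspan3 (allu (f p)).
  apply: (@coordinatization_plane _ _ _ _ f'_coord _ (lam (g x)) (lam (g y)) (lam (g z)) _ b c);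
    try by apply: span_gen; right; rewrite /=; tauto.
    exact: span_subspace.
  rewrite fK in pE; rewrite pE /=.
  have {}abc : 1 = a * 1 + b * 1 + c * 1 := abc; rewrite !mulr1 in abc.
  have -> : a = 1 - b - c by rewrite abc addrAC !addrK.
  rewrite !scalerBl scale1r !scalerBr.
  have shuffle (i j k m n : V') : i - j - k + m + n = i + (m - j) + (n - k).
    by rewrite !addrA [i - j - k + m]addrAC [i - j + m]addrAC [_ - k + n]addrAC.
  exact: shuffle.
have [c [s [cD cZ cA]]] := semilinear_lift sF sF' h_line h_reflect h_neq0 h_proj_inj h_dim
  coordinates_big coordinates_off_line.
have sI : injective s.
  move=> a b ab; apply/eqP; rewrite -subr_eq0; apply/negPn/negP => /sF.
  by move/(rmorph_unit s); rewrite rmorphB ab subrr unitr0.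
have s_onto := mono_onto s sI.
(* If this coordinate were nonzero, a preimage [t] of [- (c x).2^-1] under [s] would make the last
   coordinate of [c (t *: x) + h 0] vanish. This vector is a nonzero multiple of [h (t *: x)], whose
   last coordinate is 1. *)
have c2 x : (c x).2 = 0.
  apply/eqP/negPn/negP => a0; have [t tE] := s_onto (- (c x).2^-1).
  have [mu [mu0 [_ muE]]] := cA (t *: x); case/eqP: mu0.
  have {}muE : (c (t *: x)).2 + 1 = mu * 1 := muE; rewrite mulr1 in muE.
  have cE : (c (t *: x)).2 = s t * (c x).2 by rewrite cZ.
  rewrite -muE cE tE mulNr mulVr ?addNr //.
  exact: sF'.
(* With [c x] at infinity, the last coordinate forces [mu = 1], so [lam] is semiaffine. *)
have hE x : h x = h 0 + c x.
  have [mu [_ E]] := cA x; have [_ E2] := E.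
  have m1 : mu = 1 by have {}E2 : (c x).2 + 1 = mu * 1 := E2; rewrite c2 add0r mulr1 in E2.
  by rewrite addrC E m1 scale1r.
(* On a secant through [P], a preimage under [s] of the parameter of [P] is the parameter of the
   point sought. *)
have [p [q [l [pq pl ql Pl]]]] := secant phi_bij lam_incE pencil P.
have lpq : lam p <> lam q by move/lam_inj.
have [y yE] := (coordinatization_line f'_coord P lpq
  ((lam_incE _ _).2 pl) ((lam_incE _ _).2 ql)).1 Pl.
have [t tE] := s_onto y.
exists (g (f p + t *: (f q - f p))); apply: f'I.
have cB : c (f q - f p) = c (f q) - c (f p).
  by apply: (addIr (c (f p))); rewrite -cD !subrK.
have : h (f p + t *: (f q - f p)) = h (f p) + y *: (h (f q) - h (f p)).
  rewrite hE cD cZ tE cB addrA -hE; congr (_ + _ *: _).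
  by rewrite (hE (f q)) (hE (f p)) opprD addrACA subrr add0r.
by move=> [-> _]; rewrite !fK yE.
Qed.
End CoordinateSurjectivity.

Theorem theorem4 (A A' : affine_space)
  (phi : line A -> line A') (lam : point A -> point A') :
  dim_ge A' 3 ->
  bijective phi ->
  (forall a b, related a b -> related (phi a) (phi b)) ->
  (forall a b p, adjacent a b -> inc p a -> inc p b ->
     inc (lam p) (phi a) /\ inc (lam p) (phi b)) ->
  ( (* (1) *) (finite_space A \/ finite_space A')
    \/ (* (2) *) ((exists N, ~ dim_ge A' N) /\
                  (forall n, dim_ge A n -> dim_ge A' n))
    \/ (* (3) *) (~ order_two A /\
         exists (F F' : unitRingType) (V : lmodType F) (V' : lmodType F')
                (f : point A -> V) (f' : point A' -> V'),
           coordinatization f /\ coordinatization f' /\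
           forall g : {rmorphism F -> F'}, injective g ->
             forall y : F', exists x : F, g x = y)
    \/ (* (4) *) (order_two A /\ order_two A') ) ->
  collineation lam.
Proof.
move=> dim3 phi_bij _ lam_meet cond.
have dim2 : dim_ge A' 2 by exact: dim_ge_leq dim3.
have lam_inj := point_map_inj dim2 phi_bij lam_meet.
have lam_incE := point_map_incE dim2 phi_bij lam_meet.
have pencil := source_pencil dim2 phi_bij.
apply: (surjective_collineation dim2 phi_bij lam_meet).
have fin_surj := finite_surj phi_bij lam_incE pencil.
case: cond => [[finA|finA']|[[finN dimAA']|[[bigA]|[_ o2]]]].
- exact: fin_surj.
- exact: fin_surj (finite_source lam_inj pencil finA').
- have [o2|bigA] := classic (order_two A); last first.
    exact: (finite_dim_surj phi_bij lam_inj lam_incE pencil bigA finN dimAA').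
  apply: fin_surj; have [u uP] : exists u, forall x, span (adjoin_seq (@empty_set A) u) x.
    by apply: finite_dim_spanning; have [N nN] := finN; exists N => /dimAA'.
  by have [v vP] := order_two_span_finite o2 u; exists v => x; apply: vP.
- move=> [F [F' [V [V' [f [f' [fc [f'c mono]]]]]]]].
  exact: (coordinates_surj phi_bij lam_inj lam_incE pencil bigA dim3 fc f'c mono).
- exact: (order_two_surj phi_bij lam_inj lam_incE pencil o2).
Qed.
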